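(* Let $G$ and $H$ be locally compact groups. Suppose that $\phi:G^*\to H^*$ is a continuous isomorphism and that either $G$ or $H$ is discrete. Then there is a unique topological isomorphism $\psi:G\to H$ such that $\phi=\tilde\psi|_{G^*}$. In particular, $G$ and $H$ are isomorphic as topological groups.
   Context: Locally compact groups are Hausdorff and functions are complex-valued. For a locally compact group $G$, $C_b(G)$ is the Banach space of bounded continuous functions with the uniform norm, $l_gf(x)=f(gx)$, and $LUC(G)$ is the $C^*$-algebra of $f\in C_b(G)$ such that $g\mapsto l_gf$, $G\to C_b(G)$, is norm continuous. $LUC(G)^*$ is a Banach algebra with product $\langle m\cdot n,f\rangle=\langle m,nf\rangle$, where $nf(g)=\langle n,l_gf\rangle$. $G^{luc}\subseteq LUC(G)^*$ is the Gelfand spectrum of $LUC(G)$ (nonzero multiplicative linear functionals), a compact semigroup under this product and the weak-star topology. $G$ is identified with its image in $G^{luc}$ under point evaluations, and $G^*=G^{luc}\setminus G$ is a closed ideal of $G^{luc}$, with the subspace topology. A continuous isomorphism $G^*\to H^*$ is a continuous bijective semigroup homomorphism. For a continuous homomorphism $\psi:G\to H$, $\tilde\psi:G^{luc}\to H^{luc}$ is the unique continuous homomorphism extending $\psi$; explicitly $\langle\tilde\psi(p),f\rangle=\langle p,f\circ\psi\rangle$ for $p\in G^{luc}$, $f\in LUC(H)$.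
   Formalization: The formal theorem assumes that G^* is nonempty (i.e. G is not compact); otherwise the claim fails, e.g. for G trivial and H = Z/2, where G^* and H^* are both empty. *)

(* Defs.v *)
From HB Require Import structures.
From mathcomp Require Import all_boot all_order all_algebra.
From mathcomp Require Import complex.
From mathcomp Require Import all_classical all_reals topology normedtype.

Set Implicit Arguments.
Unset Strict Implicit.
Unset Printing Implicit Defensive.

Import Order.TTheory GRing.Theory Num.Theory.
Import numFieldNormedType.Exports.

Local Open Scope classical_set_scope.
Local Open Scope complex_scope.
Local Open Scope ring_scope.

(* The topology on the complex numbers given by the modulus. *)
HB.instance Definition _ (R : realType) := NormedModule.copy R[i] R[i]^o.

HB.mixin Record isTopologicalGroup G of Topological G & Group G := {
  mulg_continuous : continuous (fun x : G * G => (x.1 * x.2)%g);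
  invg_continuous : continuous (fun x : G => x^-1%g)
}.

#[short(type="topologicalGroupType")]
HB.structure Definition TopologicalGroup :=
  {G of Topological G & Group G & isTopologicalGroup G}.

Section bounded_continuous_functions.
Context (R : realType) (T : topologicalType).

Definition bcfun_pred : {pred T -> R[i]} :=
  mem [set f : T -> R[i] | continuous f /\ bounded_fun f].

Record bcfun := BCFun {
  bcfun_val :> T -> R[i];
  bcfun_valP : bcfun_val \in bcfun_pred }.

HB.instance Definition _ := [isSub for bcfun_val].
HB.instance Definition _ := [Choice of bcfun by <:].

Lemma bounded_funE (f : T -> R[i]) :
  bounded_fun f <-> exists M, forall x, `|f x| <= M.
Proof.
rewrite /= /bounded_near; split=> [|[M fM]].
  by move=> /pinfty_ex_gt0[M M0 fM]; exists M => x; apply: fM.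
exists `|M|; split=> [|k Mk x _ /=]; first exact: normr_real.
have M0 : 0 <= M := le_trans (normr_ge0 _) (fM x).
by apply: le_trans (fM x) _; rewrite -(ger0_norm M0) ltW.
Qed.

Lemma bcfun_predP (f : T -> R[i]) : reflect
  (continuous f /\ exists M, forall x, `|f x| <= M) (f \in bcfun_pred).
Proof.
apply: (iffP idP).
  by rewrite inE => -[cf /bounded_funE].
by move=> [cf bf]; rewrite inE; split => //; apply/bounded_funE.
Qed.

Lemma bcfun_subring_closed : subring_closed bcfun_pred.
Proof.
split=> [|f g|f g].
- apply/bcfun_predP; split; first by move=> x; exact: cvg_cst.
  by exists 1 => x; rewrite normr1.
- move=> /bcfun_predP[cf [M fM]] /bcfun_predP[cg [N gN]].
  apply/bcfun_predP; split; first by move=> x; apply: continuousB; [exact: cf|exact: cg].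
  exists (M + N) => x; apply: (le_trans (ler_normB _ _)).
  exact: lerD.
- move=> /bcfun_predP[cf [M fM]] /bcfun_predP[cg [N gN]].
  apply/bcfun_predP; split; first by move=> x; apply: continuousM; [exact: cf|exact: cg].
  by exists (M * N) => x; rewrite normrM ler_pM.
Qed.

HB.instance Definition _ :=
  GRing.isSubringClosed.Build _ bcfun_pred bcfun_subring_closed.
HB.instance Definition _ :=
  GRing.SubChoice_isSubComPzRing.Build _ _ bcfun bcfun_subring_closed.

Lemma bcfun_scaler_closed : scaler_closed bcfun_pred.
Proof.
move=> a f /bcfun_predP[cf [M fM]].
apply/bcfun_predP; split.
  by move=> x; apply: continuousZl_tmp; exact: cf.
exists (`|a| * M) => x.
by rewrite [X in `|X|](_ : _ = a * f x)// normrM ler_wpM2l.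
Qed.

HB.instance Definition _ :=
  GRing.isScaleClosed.Build _ _ bcfun_pred bcfun_scaler_closed.
HB.instance Definition _ := [SubZmodule_isSubLmodule of bcfun by <:].

(* Norms over R[i] take values in R[i]; the supremum is computed in R. *)
Definition uniform_norm (f : bcfun) : R[i] :=
  (sup (range (fun x => complex.Re `|f x|)))%:C.

Lemma normcRe (z : R[i]) : `|z| = (complex.Re `|z|)%:C.
Proof. by []. Qed.

Lemma uniform_norm_ge (f : bcfun) x : `|f x| <= uniform_norm f.
Proof.
rewrite normcRe /uniform_norm lecR; apply: sup_upper_bound; last by exists x.
split; first by exists (complex.Re `|f x|), x.
have /bcfun_predP[_ [M fM]] := bcfun_valP f.
exists (complex.Re M) => _ [y _ <-]; have := fM y.
by rewrite lecE => /andP[].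
Qed.

Lemma uniform_norm_ge0 f : 0 <= uniform_norm f.
Proof.
have [E|/set0P[_ [x _ _]]] :=
    eqVneq (range (fun x => complex.Re `|f x|)) set0.
  by rewrite /uniform_norm E sup0.
exact: le_trans (normr_ge0 _) (uniform_norm_ge f x).
Qed.

Lemma uniform_norm_le (f : bcfun) (M : R[i]) :
  0 <= M -> (forall x, `|f x| <= M) -> uniform_norm f <= M.
Proof.
move=> M0 fM.
have ME : M = (complex.Re M)%:C.
  by move: M0; rewrite lecE => /andP[/eqP M0 _]; case: M M0 {fM} => a b /= ->.
rewrite ME /uniform_norm lecR.
have [->|/set0P ne] := eqVneq (range (fun x => complex.Re `|f x|)) set0.
  by rewrite sup0; move: M0; rewrite lecE => /andP[].
apply: ge_sup => // _ [x _ <-].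
by have := fM x; rewrite lecE => /andP[].
Qed.

Lemma uniform_normD f g :
  uniform_norm (f + g) <= uniform_norm f + uniform_norm g.
Proof.
apply: uniform_norm_le; first by rewrite addr_ge0 ?uniform_norm_ge0.
move=> x; apply: (le_trans (ler_normD (f x) (g x))).
by rewrite lerD ?uniform_norm_ge.
Qed.

Lemma uniform_normZ (a : R[i]) f :
  uniform_norm (a *: f) = `|a| * uniform_norm f.
Proof.
have H (b : R[i]) h : uniform_norm (b *: h) <= `|b| * uniform_norm h.
  apply: uniform_norm_le; first by rewrite mulr_ge0 ?uniform_norm_ge0.
  move=> x; rewrite [X in `|X|](_ : _ = b * h x)// normrM.
  by rewrite ler_wpM2l ?uniform_norm_ge.
apply/eqP; rewrite eq_le H /=.
have [->|a0] := eqVneq a 0; first by rewrite normr0 mul0r uniform_norm_ge0.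
have := H a^-1 (a *: f); rewrite scalerA mulVf// scale1r normrV ?unitfE//.
by rewrite ler_pdivlMl ?normr_gt0.
Qed.

Lemma uniform_norm0_eq0 f : uniform_norm f = 0 -> f = 0.
Proof.
move=> f0; apply/val_inj/funext => x /=.
have := uniform_norm_ge f x; rewrite f0 => fx0.
by apply/eqP; rewrite -normr_le0.
Qed.

HB.instance Definition _ := Lmodule_isNormed.Build R[i] bcfun
  uniform_normD uniform_normZ uniform_norm0_eq0.

End bounded_continuous_functions.

Section left_translation.
Context {R : realType} {G : topologicalGroupType}.
Implicit Types (f : bcfun R G) (g h x : G).

Lemma mulg_continuousl (g : G) : continuous (fun x : G => (g * x)%g).
Proof.
move=> x; apply: (@continuous_comp _ _ _ (fun x => (g, x))
  (fun z : G * G => (z.1 * z.2)%g)); last exact: mulg_continuous.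
by apply: cvg_pair; [exact: cvg_cst|exact: cvg_id].
Qed.

Lemma ltransl_subproof g f : (fun x => f (g * x)%g) \in @bcfun_pred R G.
Proof.
have /bcfun_predP[cf [M fM]] := bcfun_valP f.
apply/bcfun_predP; split; last by exists M.
by move=> x; apply: continuous_comp; [exact: mulg_continuousl|exact: cf].
Qed.

Definition ltransl g f : bcfun R G := BCFun (ltransl_subproof g f).

Lemma ltranslM g h f : ltransl h (ltransl g f) = ltransl (g * h)%g f.
Proof. by apply/val_inj/funext => x /=; rewrite mulgA. Qed.

Lemma norm_ltransl g f : `|ltransl g f| <= `|f|.
Proof. by apply: uniform_norm_le => // x; exact: (uniform_norm_ge f (g * x)%g). Qed.

Lemma norm_bcfunM f1 f2 : `|f1 * f2| <= `|f1| * `|f2|.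
Proof.
apply: uniform_norm_le => [|x]; first by rewrite mulr_ge0.
rewrite [X in `|X|](_ : _ = f1 x * f2 x)// normrM.
by rewrite ler_pM//; exact: uniform_norm_ge.
Qed.

Definition luc_pred : {pred bcfun R G} :=
  mem [set f | continuous (fun g => ltransl g f)].

Lemma luc_predP f : reflect
  (forall g e, 0 < e -> \forall h \near g, `|ltransl g f - ltransl h f| <= e)
  (f \in luc_pred).
Proof.
apply: (iffP idP).
  by rewrite inE => cf g e e0; move/cvgrPdist_le: (cf g); apply.
by move=> cf; rewrite inE => g; apply/cvgrPdist_le => e e0; exact: cf.
Qed.

Lemma luc_subring_closed : subring_closed luc_pred.
Proof.
split=> [|f1 f2|f1 f2].
- rewrite inE => g.
  rewrite (_ : (fun _ => _) = cst 1); first exact: cvg_cst.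
  by apply/funext => h; apply/val_inj.
- rewrite !inE => c1 c2 g.
  rewrite (_ : (fun _ => _) = fun h => ltransl h f1 - ltransl h f2).
    by apply: cvgB; [exact: c1|exact: c2].
  by apply/funext => h; apply/val_inj.
- move=> /luc_predP c1 /luc_predP c2; apply/luc_predP => g e e0.
  have N0 : 0 < `|f1| + `|f2| + 1 by rewrite ltr_wpDl ?addr_ge0.
  have -> : e = (`|f1| + `|f2| + 1) * (e / (`|f1| + `|f2| + 1)).
    by rewrite mulrC divfK// gt_eqF.
  set d := e / _.
  have d0 : 0 < d by rewrite divr_gt0.
  near=> h.
  rewrite (_ : _ - _ =
    ltransl g f1 * (ltransl g f2 - ltransl h f2) +
    (ltransl g f1 - ltransl h f1) * ltransl h f2); last first.
    by rewrite mulrBr mulrBl addrA subrK; congr (_ - _); apply/val_inj.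
  apply: (le_trans (ler_normD _ _)).
  apply: (@le_trans _ _ (`|f1| * d + d * `|f2|)).
    apply: lerD; apply: le_trans (norm_bcfunM _ _) _; apply: ler_pM => //.
    + exact: norm_ltransl.
    + by near: h; exact: (c2 g d d0).
    + by near: h; exact: (c1 g d d0).
    + exact: norm_ltransl.
  rewrite [d * _]mulrC -mulrDl ler_wpM2r ?(ltW d0)//.
  by rewrite lerDl.
Unshelve. all: by end_near. Qed.

Lemma luc_scaler_closed : scaler_closed luc_pred.
Proof.
move=> a f; rewrite !inE => cf g.
rewrite (_ : (fun _ => _) = fun h => a *: ltransl h f).
  by apply: cvgZl_tmp; exact: cf.
by apply/funext => h; apply/val_inj.
Qed.

HB.instance Definition _ :=
  GRing.isSubringClosed.Build _ luc_pred luc_subring_closed.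
HB.instance Definition _ :=
  GRing.isScaleClosed.Build _ _ luc_pred luc_scaler_closed.

End left_translation.

Section luc.
Context (R : realType) (G : topologicalGroupType).

Record luc := Luc {
  luc_val :> bcfun R G;
  luc_valP : luc_val \in luc_pred }.

HB.instance Definition _ := [isSub for luc_val].
HB.instance Definition _ := [Choice of luc by <:].
HB.instance Definition _ :=
  GRing.SubChoice_isSubComPzRing.Build _ _ luc (@luc_subring_closed R G).
HB.instance Definition _ := [SubZmodule_isSubLmodule of luc by <:].

(* LUC(G) is normed as a subspace of C_b(G). *)
Definition luc_norm (f : luc) : R[i] := `|luc_val f|.

Lemma luc_normD f g : luc_norm (f + g) <= luc_norm f + luc_norm g.
Proof. exact: ler_normD. Qed.

Lemma luc_normZ (a : R[i]) f : luc_norm (a *: f) = `|a| * luc_norm f.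
Proof. exact: normrZ. Qed.

Lemma luc_norm0_eq0 f : luc_norm f = 0 -> f = 0.
Proof. by move=> /normr0_eq0 f0; exact/val_inj. Qed.

HB.instance Definition _ :=
  Lmodule_isNormed.Build R[i] luc luc_normD luc_normZ luc_norm0_eq0.

End luc.

Section luc_dual.
Context {R : realType} {G : topologicalGroupType}.
Implicit Types (f : luc R G) (g h x : G).

Definition luc_dual_pred : {pred luc R G -> R[i]} :=
  mem [set m : luc R G -> R[i] | scalar m /\ continuous m].

Record luc_dual := LucDual {
  luc_dual_val :> luc R G -> R[i];
  luc_dual_valP : luc_dual_val \in luc_dual_pred }.

HB.instance Definition _ := [isSub for luc_dual_val].
HB.instance Definition _ := [Choice of luc_dual by <:].

Lemma luc_dual_scalar (m : luc_dual) : scalar m.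
Proof. by have := luc_dual_valP m; rewrite inE => -[]. Qed.

HB.instance Definition _ (m : luc_dual) :=
  GRing.isLinear.Build R[i] (luc R G) R[i] _ m (luc_dual_scalar m).

Lemma luc_dual_predP (m : luc R G -> R[i]) : reflect
  (scalar m /\ exists2 M, 0 <= M & forall f, `|m f| <= M * `|f|)
  (m \in luc_dual_pred).
Proof.
apply: (iffP idP); rewrite inE => -[lm].
  pose lm' : {linear luc R G -> R[i]} :=
    HB.pack m (GRing.isLinear.Build R[i] (luc R G) R[i] _ m lm).
  move=> /(@linear_bounded_continuous _ _ _ lm')/linear_boundedP.
  by move=> /pinfty_ex_gt0[M M0 mM]; split=> //; exists M => //; exact: ltW.
move=> [M M0 mM]; split => //.
pose lm' : {linear luc R G -> R[i]} :=
  HB.pack m (GRing.isLinear.Build R[i] (luc R G) R[i] _ m lm).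
apply/(@linear_bounded_continuous _ _ _ lm')/linear_boundedP.
exists M; split=> [|k Mk f /=]; first exact: ger0_real.
by apply: le_trans (mM f) _; rewrite ler_wpM2r// ltW.
Qed.

Lemma luc_ltransl_subproof g f : ltransl g f \in luc_pred.
Proof.
have cf := luc_valP f; rewrite inE in cf; rewrite inE /= => h.
rewrite (_ : (fun _ => _) = (fun h => ltransl h f) \o (fun h => (g * h)%g)).
  by apply: continuous_comp; [exact: mulg_continuousl|exact: cf].
by apply/funext => k; rewrite /= ltranslM.
Qed.

Definition luc_ltransl g f : luc R G := Luc (luc_ltransl_subproof g f).

Lemma introversion_bc (n : luc_dual) f :
  (fun g => n (luc_ltransl g f)) \in @bcfun_pred R G.
Proof.
have /luc_dual_predP[_ [M M0 nM]] := luc_dual_valP n.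
apply/bcfun_predP; split; last first.
  exists (M * `|f|) => g; apply: (le_trans (nM _)).
  by rewrite ler_wpM2l//; exact: norm_ltransl.
move=> g; apply/cvgrPdist_le => e e0.
have M1 : 0 < M + 1 by rewrite ltr_wpDl.
have /luc_predP/(_ g (e / (M + 1))) := luc_valP f.
rewrite divr_gt0// => /(_ isT); apply: filterS => h fgh.
rewrite -linearB; apply: (le_trans (nM _)).
rewrite (_ : e = (M + 1) * (e / (M + 1))); last first.
  by rewrite mulrC divfK// gt_eqF.
by apply: ler_pM => //; rewrite lerDl.
Qed.

Lemma introversion_luc (n : luc_dual) f :
  BCFun (introversion_bc n f) \in luc_pred.
Proof.
have /luc_dual_predP[_ [M M0 nM]] := luc_dual_valP n.
apply/luc_predP => g e e0.
have M1 : 0 < M + 1 by rewrite ltr_wpDl.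
have /luc_predP/(_ g (e / (M + 1))) := luc_valP f.
rewrite divr_gt0// => /(_ isT); apply: filterS => h fgh.
rewrite (_ : e = (M + 1) * (e / (M + 1))); last first.
  by rewrite mulrC divfK// gt_eqF.
apply: uniform_norm_le => [|x].
  by rewrite mulr_ge0 ?ltW// divr_gt0.
rewrite [X in `|X|](_ : _ =
  n (luc_ltransl (g * x)%g f) - n (luc_ltransl (h * x)%g f))//.
rewrite -linearB; apply: (le_trans (nM _)).
apply: ler_pM => //; first by rewrite lerDl.
apply: le_trans fgh.
have := norm_ltransl x (ltransl g f - ltransl h f).
rewrite (_ : ltransl x _ = ltransl (g * x)%g f - ltransl (h * x)%g f)//.
by rewrite -!ltranslM; apply/val_inj.
Qed.

(* n f : g |-> <n, l_g f> *)
Definition introversion (n : luc_dual) f : luc R G :=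
  Luc (introversion_luc n f).

Lemma luc_dual_mul_subproof (m n : luc_dual) :
  (fun f => m (introversion n f)) \in luc_dual_pred.
Proof.
have /luc_dual_predP[_ [M M0 mM]] := luc_dual_valP m.
have /luc_dual_predP[_ [N N0 nN]] := luc_dual_valP n.
apply/luc_dual_predP; split=> [a f1 f2|].
  rewrite -[RHS](luc_dual_scalar m); congr (m _).
  apply/val_inj/val_inj/funext => x /=.
  rewrite -[RHS](luc_dual_scalar n); congr (n _).
  by apply/val_inj/val_inj.
exists (M * N) => [|f]; first exact: mulr_ge0.
apply: (le_trans (mM _)); rewrite -mulrA ler_wpM2l//.
apply: uniform_norm_le => [|x]; first by rewrite mulr_ge0.
by apply: (le_trans (nN _)); rewrite ler_wpM2l//; exact: norm_ltransl.
Qed.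

(* <m . n, f> = <m, n f> *)
Definition luc_dual_mul (m n : luc_dual) : luc_dual :=
  LucDual (luc_dual_mul_subproof m n).

Lemma luc_eval_subproof g : (fun f : luc R G => f g) \in luc_dual_pred.
Proof.
apply/luc_dual_predP; split=> [//|]; exists 1 => // f.
by rewrite mul1r; exact: uniform_norm_ge.
Qed.

Definition luc_eval g : luc_dual := LucDual (luc_eval_subproof g).

(* The weak-star topology, not the one of the dual norm. *)
HB.instance Definition _ := Topological.copy luc_dual
  (initial_topology (luc_dual_val : luc_dual -> {ptws luc R G -> R[i]})).

End luc_dual.

Arguments luc_dual : clear implicits.
Arguments luc_eval : clear implicits.

Section spectrum.
Context (R : realType) (G : topologicalGroupType).

(* G^luc, as a subset of LUC(G)^*. *)
Definition luc_spectrum : set (luc_dual R G) :=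
  [set p | (exists f, p f != 0) /\ {morph p : f1 f2 / f1 * f2}].

(* G^* = G^luc \ G, where g in G is identified with the evaluation at g. *)
Definition luc_remainder : set (luc_dual R G) :=
  luc_spectrum `\` range (luc_eval R G).

End spectrum.

Arguments luc_spectrum : clear implicits.
Arguments luc_remainder : clear implicits.

Record continuous_hom (G H : topologicalGroupType) := ContinuousHom {
  continuous_hom_fun :> G -> H;
  continuous_homP :
    continuous continuous_hom_fun /\
    {morph continuous_hom_fun : x y / (x * y)%g} }.

Definition topological_iso (G H : topologicalGroupType)
    (psi : continuous_hom G H) :=
  exists2 theta : continuous_hom H G,
    cancel psi theta & cancel theta psi.

Section luc_extension.
Context {R : realType} {G H : topologicalGroupType}.
Variable psi : continuous_hom G H.

Lemma bcfun_comp_subproof (f : bcfun R H) : f \o psi \in @bcfun_pred R G.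
Proof.
have /bcfun_predP[cf [M fM]] := bcfun_valP f.
apply/bcfun_predP; split; last by exists M => x; exact: fM.
move=> x; apply: continuous_comp; last exact: cf.
exact: (continuous_homP psi).1.
Qed.

Definition bcfun_comp (f : bcfun R H) : bcfun R G :=
  BCFun (bcfun_comp_subproof f).

Lemma norm_bcfun_comp f : `|bcfun_comp f| <= `|f|.
Proof.
by apply: uniform_norm_le => // x; exact: (uniform_norm_ge f (psi x)).
Qed.

Lemma luc_comp_subproof (f : luc R H) : bcfun_comp f \in luc_pred.
Proof.
have E k : ltransl k (bcfun_comp f) = bcfun_comp (ltransl (psi k) f).
  by apply/val_inj/funext => x /=; rewrite (continuous_homP psi).2.
apply/luc_predP => g e e0.
have /luc_predP/(_ (psi g) e e0) := luc_valP f.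
move=> fe; have {}fe := (continuous_homP psi).1 g _ fe.
near=> h.
rewrite !E.
have := norm_bcfun_comp (ltransl (psi g) f - ltransl (psi h) f).
rewrite (_ : bcfun_comp (_ - _) = bcfun_comp (ltransl (psi g) f) -
  bcfun_comp (ltransl (psi h) f)); last exact/val_inj.
by move/le_trans; apply; near: h; exact: fe.
Unshelve. all: by end_near. Qed.

Definition luc_comp (f : luc R H) : luc R G := Luc (luc_comp_subproof f).

Lemma luc_extension_subproof (p : luc_dual R G) :
  (fun f => p (luc_comp f)) \in luc_dual_pred.
Proof.
have /luc_dual_predP[_ [M M0 pM]] := luc_dual_valP p.
apply/luc_dual_predP; split=> [a f1 f2|].
  rewrite -[RHS](luc_dual_scalar p); congr (p _).
  by apply/val_inj/val_inj/funext.
exists M => // f; apply: (le_trans (pM _)).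
by rewrite ler_wpM2l//; exact: norm_bcfun_comp.
Qed.

(* The adjoint of f |-> f \o psi; its restriction to G^luc is the extension
   of psi to a continuous homomorphism G^luc -> H^luc. *)
Definition luc_extension (p : luc_dual R G) : luc_dual R H :=
  LucDual (luc_extension_subproof p).

End luc_extension.

(* A map G^* -> H^* is represented by a map on the whole of LUC(G)^* whose
   values outside G^* are irrelevant; since G^* is an ideal of G^luc, the
   products below are taken in G^* and in H^*. *)
Definition continuous_isomorphism (R : realType) (G H : topologicalGroupType)
    (phi : luc_dual R G -> luc_dual R H) :=
  [/\ set_bij (luc_remainder R G) (luc_remainder R H) phi,
      {within luc_remainder R G, continuous phi} &
      forall p q, luc_remainder R G p -> luc_remainder R G q ->
        phi (luc_dual_mul p q) = luc_dual_mul (phi p) (phi q)].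

(* Main.v *)
(* Let D be the discrete one of the two groups and E the other one; write E* and
   D* for the remainders. E* is compact, so phi is a homeomorphism, and composing
   it with the translations by g in E gives bijections L and M of D* such that
   M(a) p = a L(p). Let p be in the closure of a thin sequence, i.e. one that
   meets each of its translates in a finite set; then p is right cancellable and
   not in D* D*. Suppose that x = L(p) is not in the orbit D p. Then x is not in
   D^luc p and p is not in D^luc x, and if x is in the closure of a countable set
   a diagonal argument gives some a in D* with a x outside D^luc p, contradicting
   a x = M(a) p. Such points p are dense in D*, hence L is the translation by
   some psi(g) in D. The map psi is locally constant because the orbit D p is
   discrete, and injective because E acts faithfully on E*; hence E is discrete.
   By right cancellation phi is the restriction of the extension of psi, and psi
   is onto because D* is covered by the closure of psi(E). *)
Require Import Defs.
From HB Require Import structures.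
From mathcomp Require Import all_boot all_order all_algebra.
From mathcomp Require Import complex.
From mathcomp Require Import all_classical all_reals topology normedtype.

Set Implicit Arguments.
Unset Strict Implicit.
Unset Printing Implicit Defensive.

Local Open Scope classical_set_scope.
Local Open Scope ring_scope.

Import Order.TTheory GRing.Theory Num.Theory.
Import numFieldNormedType.Exports.
Local Open Scope complex_scope.

(** * The weak-star topology of LUC(G)^* *)

Lemma proper_ultra (T : Type) (F : set_system T) :
  ProperFilter F -> (forall A, F A \/ F (~` A)) -> UltraFilter F.
Proof.
move=> PF FA; split=> // U PU FU; apply/seteqP; split=> // A UA.
have [//|/FU UcA] := FA A.
by have /filter_ex[x []] : U (A `&` ~` A) by exact: filterI.
Qed.

Lemma fmap_ultra (T U : Type) (f : T -> U) (F : set_system T) :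
  UltraFilter F -> UltraFilter (f @ F).
Proof.
by move=> UF; apply: proper_ultra => A; exact: (in_ultra_setVsetC (f @^-1` A)).
Qed.

Section complex_limits.
Context {R : realType} {T : Type}.
Implicit Types (F : set_system T) (u : T -> R[i]).

Lemma norm_le_Re_Im (z : R[i]) : `|z| <= (`|complex.Re z| + `|complex.Im z|)%:C.
Proof.
have {1}-> : z = (complex.Re z)%:C + (complex.Im z)*i by case: z => a b; simpc.
apply: le_trans (ler_normD _ _) _.
by rewrite !normc_def /= expr0n /= addr0 add0r !sqrtr_sqr -rmorphD.
Qed.

Lemma norm_Re_le (z : R[i]) : `|complex.Re z| <= complex.Re `|z|.
Proof. by rewrite -lecR; exact: normc_ge_Re. Qed.

Lemma norm_Im_le (z : R[i]) : `|complex.Im z| <= complex.Re `|z|.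
Proof.
rewrite normc_def /=; case: z => a b /=.
by rewrite -sqrtr_sqr ler_wsqrtr// lerDr sqr_ge0.
Qed.

(** Real and imaginary parts stay in a compact segment, where every ultrafilter converges. *)
Lemma ultra_bounded_cvg F u (M : R[i]) :
  UltraFilter F -> (\forall x \near F, `|u x| <= M) -> exists l : R[i], u @ F --> l.
Proof.
move=> UF uM.
have C (v : T -> R) : (\forall x \near F, `|v x| <= complex.Re M) ->
    exists l : R, v @ F --> l.
  move=> vM.
  have := @segment_compact R (- complex.Re M) (complex.Re M).
  rewrite compact_ultra => /(_ (v @ F) (fmap_ultra v UF))[|l [_ vl]]; last by exists l.
  by apply: filterS vM => x; rewrite /= in_itv /= ler_norml.
have [a ua] : exists a : R, (@complex.Re R \o u) @ F --> a.
  apply: C; apply: filterS uM => x; rewrite lecE => /andP[_].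
  exact/le_trans/norm_Re_le.
have [b ub] : exists b : R, (@complex.Im R \o u) @ F --> b.
  apply: C; apply: filterS uM => x; rewrite lecE => /andP[_].
  exact/le_trans/norm_Im_le.
exists (a +i* b); apply/cvgrPdist_le => e e0.
have /complex_realP[r er] := gtr0_real e0.
move: e0; rewrite er ltcR => r0.
have r20 : 0 < r / 2 by rewrite divr_gt0.
near=> x.
apply: le_trans (norm_le_Re_Im _) _; rewrite lecR [leRHS]splitr.
case E : (u x) => [c d] /=; apply: lerD.
  have -> : c = (@complex.Re R \o u) x by rewrite /= E.
  by near: x; move/cvgrPdist_le : ua; apply.
have -> : d = (@complex.Im R \o u) x by rewrite /= E.
by near: x; move/cvgrPdist_le : ub; apply.
Unshelve. all: by end_near. Qed.

Lemma complex_cvg_unique F {PF : ProperFilter F} u (a b : R[i]) :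
  u @ F --> a -> u @ F --> b -> a = b.
Proof. exact: cvg_unique. Qed.

End complex_limits.

Section luc_dual_topology.
Context {R : realType} {G : topologicalGroupType}.
Local Notation X := (luc_dual R G).
Implicit Types (p q m : X) (f : luc R G) (g h : G).

Lemma luc_dual_eqP p q : (forall f, p f = q f) -> p = q.
Proof. by move=> pq; apply/val_inj/funext. Qed.

Lemma luc_dual_cvgP (F : set_system X) (m : X) : Filter F ->
  F --> m <-> forall f, (fun k : X => k f) @ F --> m f.
Proof.
move=> FF; have -> : (F --> m) <->
    {ptws, luc_dual_val @ F --> (m : luc R G -> R[i])}.
  split=> [Fm A /initial_continuous mA|Fm A [_ [[B oB <-] Bm sBA]]].
    by apply: Fm; exact: mA.
  by rewrite nbhs_simpl; apply: (filterS sBA); apply: Fm; exact: open_nbhs_nbhs.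
by rewrite pointwise_cvgP.
Qed.

Lemma luc_dual_eval_continuous f : continuous (fun k : X => k f).
Proof. by move=> m; have /luc_dual_cvgP := @cvg_id _ (nbhs m); apply. Qed.

Lemma luc_dual_hausdorff : hausdorff_space X.
Proof.
move=> p q /= pq; apply: luc_dual_eqP => f.
have := @norm_hausdorff _ (R[i] : normedModType R[i]); apply => A B pA qB.
have [k [kA kB]] := pq _ _ (luc_dual_eval_continuous pA) (luc_dual_eval_continuous qB).
by exists (k f).
Qed.

Lemma spectrum1 p : luc_spectrum R G p -> p 1 = 1.
Proof.
move=> [[f pf0] pM]; apply: (mulfI pf0).
by rewrite -pM !mulr1.
Qed.

Lemma spectrumM p f1 f2 : luc_spectrum R G p -> p (f1 * f2) = p f1 * p f2.
Proof. by move=> [_ ->]. Qed.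

Lemma spectrumP p : p 1 = 1 -> (forall f1 f2, p (f1 * f2) = p f1 * p f2) ->
  luc_spectrum R G p.
Proof. by move=> p1 pM; split=> //; exists 1; rewrite p1 oner_neq0. Qed.

Lemma luc_normM f1 f2 : `|f1 * f2| <= `|f1| * `|f2|.
Proof. exact: (norm_bcfunM (luc_val f1) (luc_val f2)). Qed.

(** Multiplicativity gives [|p f| ^+ n <= M * |f| ^+ n] for every positive [n], with one constant
    [M]; a ratio [|p f| / |f|] above 1 would have unbounded powers. *)
Lemma spectrum_norm_le p f : luc_spectrum R G p -> `|p f| <= `|f|.
Proof.
move=> Sp; have /luc_dual_predP[_ [M M0 pM]] := luc_dual_valP p.
have pX n : p (f ^+ n.+1) = p f ^+ n.+1.
  elim: n => [//|n IHn].
  by rewrite exprS (spectrumM _ _ Sp) IHn -exprS.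
have fX n : `|f ^+ n.+1| <= `|f| ^+ n.+1.
  elim: n => [|n IHn]; first by rewrite !expr1.
  rewrite exprS [leRHS]exprS; apply: le_trans (luc_normM _ _) _.
  by rewrite ler_wpM2l.
have [f0|f0] := eqVneq `|f| 0.
  by rewrite (normr0_eq0 f0) linear0 !normr0.
have fgt0 : 0 < `|f| by rewrite lt0r f0 normr_ge0.
rewrite real_leNgt ?normr_real//; apply/negP => fp.
pose r := `|p f| / `|f|.
have r1 : 1 < r by rewrite ltr_pdivlMr// mul1r.
have rM n : r ^+ n.+1 <= M.
  rewrite expr_div_n ler_pdivrMr ?exprn_gt0// -normrX -pX.
  by apply: le_trans (pM _) _; rewrite ler_wpM2l.
have /complex_realP[s rs] : r \is Num.real by rewrite gtr0_real// (lt_trans _ r1).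
have /complex_realP[N MN] := ger0_real M0.
have {}rM n : s ^+ n.+1 <= N.
  by rewrite -lecR -MN; have := rM n; rewrite rs -rmorphXn.
have s1 : 1 < s by rewrite -ltcR -rs.
have bernoulli n : 1 + (s - 1) *+ n <= s ^+ n.
  elim: n => [|n IHn]; first by rewrite mulr0n addr0 expr0.
  rewrite exprS -[X in X * _](subrK 1) mulrDl mul1r mulrS addrCA lerD//.
  by rewrite ler_peMr ?subr_ge0 ?(ltW s1)// exprn_ege1// ltW.
have [n Nn] : exists n, N < (s - 1) *+ n.
  have := archi_boundP (_ : 0 <= `|N / (s - 1)|); rewrite normr_ge0 => /(_ isT).
  set n := Num.bound _ => Nn; exists n.
  rewrite -mulr_natr -ltr_pdivrMl ?subr_gt0// mulrC.
  exact: le_lt_trans (ler_norm _) Nn.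
have := le_trans (bernoulli n.+1) (rM n).
rewrite leNgt => /negP; apply; apply: (lt_le_trans Nn).
by rewrite ler_wpDl// ler_wpMn2l ?subr_ge0 ?(ltW s1).
Qed.
End luc_dual_topology.

(** * The spectrum and its multiplication *)

Section spectrum.
Context {R : realType} {G : topologicalGroupType}.
Local Notation X := (luc_dual R G).
Local Notation "p ** q" := (luc_dual_mul p q) (at level 40, left associativity).
Local Notation ev := (luc_eval R G).
Implicit Types (p q m : X) (f : luc R G) (g h : G).

(** As in Alaoglu's theorem, an ultrafilter on the spectrum has a pointwise limit because [p f] is
    bounded by the norm of [f]; linearity, multiplicativity and the bound pass to the limit. *)
Lemma spectrum_compact : compact (luc_spectrum R G).
Proof.
rewrite compact_ultra => F UF FS.
have Fcvg f : exists l : R[i], (fun k : X => k f) @ F --> l.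
  apply: (@ultra_bounded_cvg _ _ _ _ `|f|).
  by apply: filterS FS => p Sp; exact: spectrum_norm_le.
have [p0 p0P] := choice Fcvg.
have p0_lin : scalar p0.
  move=> a f1 f2; apply: complex_cvg_unique (p0P _) _.
  rewrite (_ : (fun k : X => _) = fun k : X => a * k f1 + k f2).
    by apply: cvgD => //; apply: cvgMr.
  by apply/funext => k; rewrite linearP.
have p0_luc : p0 \in luc_dual_pred.
  apply/luc_dual_predP; split=> //; exists 1 => // f; rewrite mul1r.
  apply/ler_addgt0Pr => e e0.
  have [k [Sk ke]] : exists k : X, luc_spectrum R G k /\ `|p0 f - k f| <= e.
    have /cvgrPdist_le/(_ e e0) fe := p0P f.
    exact: filter_ex (filterI FS fe).
  rewrite -(subrK (k f) (p0 f)) addrC; apply: le_trans (ler_normD _ _) _.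
  by rewrite lerD// spectrum_norm_le.
exists (LucDual p0_luc); split; last exact/luc_dual_cvgP.
apply: spectrumP => /= [|f1 f2].
  apply: complex_cvg_unique (p0P _) _; apply: cvg_near_cst.
  by apply: filterS FS => k Sk; rewrite spectrum1.
apply: complex_cvg_unique (p0P _) _.
apply: cvg_trans (cvgM (p0P f1) (p0P f2)).
apply: near_eq_cvg; apply: filterS FS => k Sk.
by rewrite spectrumM.
Qed.

Lemma luc_dual_mulE p q f : (p ** q) f = p (introversion q f).
Proof. by []. Qed.

Lemma luc_dual_mulA p q m : p ** (q ** m) = (p ** q) ** m.
Proof.
apply: luc_dual_eqP => f; rewrite !luc_dual_mulE; congr (p _).
apply/val_inj/val_inj/funext => g /=; congr (q _).
apply/val_inj/val_inj/funext => h /=; congr (m _).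
by apply/val_inj; rewrite /= ltranslM.
Qed.

Lemma eval_mulE g p f : (ev g ** p) f = p (luc_ltransl g f).
Proof. by []. Qed.

Lemma eval_mul g h : ev g ** ev h = ev (g * h)%g.
Proof. exact: luc_dual_eqP. Qed.

Lemma eval1_mul p : ev 1%g ** p = p.
Proof.
apply: luc_dual_eqP => f; rewrite eval_mulE; congr (p _).
by apply/val_inj/val_inj/funext => x /=; rewrite mul1g.
Qed.

Lemma mul_eval1 p : p ** ev 1%g = p.
Proof.
apply: luc_dual_eqP => f; rewrite luc_dual_mulE; congr (p _).
by apply/val_inj/val_inj/funext => x /=; rewrite mulg1.
Qed.

Lemma eval_mulK g p : ev g^-1%g ** (ev g ** p) = p.
Proof. by rewrite luc_dual_mulA eval_mul mulVg eval1_mul. Qed.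

Lemma mul_evalK g p : p ** ev g ** ev g^-1%g = p.
Proof. by rewrite -luc_dual_mulA eval_mul mulgV mul_eval1. Qed.

Lemma mul_evalKV g p : p ** ev g^-1%g ** ev g = p.
Proof. by rewrite -luc_dual_mulA eval_mul mulVg mul_eval1. Qed.

Lemma spectrum_eval g : luc_spectrum R G (ev g).
Proof. exact: spectrumP. Qed.

Lemma spectrum_mul p q : luc_spectrum R G p -> luc_spectrum R G q ->
  luc_spectrum R G (p ** q).
Proof.
move=> Sp Sq; apply: spectrumP => [|f1 f2]; rewrite !luc_dual_mulE.
  rewrite -(spectrum1 Sp); congr (p _).
  apply/val_inj/val_inj/funext => g /=.
  rewrite -[RHS](spectrum1 Sq); congr (q _).
  exact/val_inj/val_inj/funext.
rewrite -(spectrumM _ _ Sp); congr (p _).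
apply/val_inj/val_inj/funext => g /=.
rewrite -[RHS](spectrumM _ _ Sq); congr (q _).
exact/val_inj/val_inj/funext.
Qed.

Lemma remainder_spectrum p : luc_remainder R G p -> luc_spectrum R G p.
Proof. by case. Qed.

Lemma remainder_eval_mul g p : luc_remainder R G p ->
  luc_remainder R G (ev g ** p).
Proof.
move=> [Sp Ep]; split; first exact/spectrum_mul/Sp/spectrum_eval.
move=> [h _ hp]; apply: Ep; exists (g^-1 * h)%g => //.
by rewrite -eval_mul hp eval_mulK.
Qed.

Lemma remainder_mul_eval g p : luc_remainder R G p ->
  luc_remainder R G (p ** ev g).
Proof.
move=> [Sp Ep]; split; first exact/spectrum_mul/spectrum_eval.
move=> [h _ hp]; apply: Ep; exists (h * g^-1)%g => //.
by rewrite -eval_mul hp mul_evalK.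
Qed.

Lemma luc_dual_fmap_cvgP (T : Type) (F : set_system T) (u : T -> X) m :
  Filter F -> u @ F --> m <-> forall f, (fun t => u t f) @ F --> m f.
Proof.
by move=> FF; apply: (@luc_dual_cvgP _ _ (u @ F)).
Qed.

Lemma luc_dual_continuous (T : topologicalType) (u : T -> X) :
  (forall f, continuous (fun t => u t f)) -> continuous u.
Proof.
move=> cu t; apply/(luc_dual_fmap_cvgP _ _ (nbhs_filter t)) => f; exact: cu.
Qed.

Lemma eval_mul_continuous g : continuous (fun q : X => ev g ** q).
Proof.
apply: luc_dual_continuous => f.
exact: (@luc_dual_eval_continuous _ _ (luc_ltransl g f)).
Qed.

Lemma luc_continuous f : continuous f.
Proof. by have /bcfun_predP[] := bcfun_valP (luc_val f). Qed.

(** At [f] the orbit map is the function [introversion p f], which lies in LUC(G). *)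
Lemma orbit_continuous p : continuous (fun g => ev g ** p).
Proof.
apply: luc_dual_continuous => f.
by have := @luc_continuous (introversion p f).
Qed.

End spectrum.

(** * Uniform continuity and membership in LUC(G) *)

Lemma mulg_continuousr (G : topologicalGroupType) (g : G) :
  continuous (fun x : G => (x * g)%g).
Proof.
move=> x; apply: (@continuous_comp _ _ _ (fun x => (x, g))
  (fun z : G * G => (z.1 * z.2)%g)); last exact: mulg_continuous.
by apply: cvg_pair; [exact: cvg_id|exact: cvg_cst].
Qed.

(** An estimate at 1 that is uniform in [y] transfers to every [g]: for [y = g * x], the point
    [h * x] is [(h * g^-1) * y]. *)
Lemma luc_of_unif (R : realType) (G : topologicalGroupType) (f : G -> R[i])
    (M : R[i]) :
  (forall x, `|f x| <= M) ->
  (forall e : R[i], 0 < e ->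
    \forall u \near (1%g : G), forall y, `|f y - f (u * y)%g| <= e) ->
  exists F : luc R G, forall x, F x = f x.
Proof.
move=> fM fu.
have near_shift g (e : R[i]) : 0 < e ->
    \forall h \near g, forall y, `|f y - f (h * g^-1 * y)%g| <= e.
  move=> e0; have cu : (h * g^-1)%g @[h --> g] --> (1%g : G).
    by rewrite -(mulgV g); exact: (@mulg_continuousr _ g^-1%g g).
  exact: (cu _ (fu e e0)).
have bf : f \in @bcfun_pred R G.
  apply/bcfun_predP; split; last by exists M.
  move=> x; apply/cvgrPdist_le => e e0.
  by apply: filterS (near_shift x e e0) => h /(_ x); rewrite mulgVK.
have lf : BCFun bf \in @luc_pred R G.
  apply/luc_predP => g e e0; apply: filterS (near_shift g e e0) => h he.
  apply: uniform_norm_le => [|x]; first exact: ltW.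
  by have := he (g * x)%g; rewrite mulgA -(mulgA h) mulVg mulg1.
by exists (Luc lf).
Qed.

Lemma luc_unif (R : realType) (G : topologicalGroupType) (f : luc R G)
    (e : R[i]) : 0 < e ->
  \forall u \near (1%g : G), forall y, `|f y - f (u * y)%g| <= e.
Proof.
move=> e0; have /luc_predP/(_ 1%g e e0) := luc_valP f.
apply: filterS => u ue y; apply: le_trans ue.
rewrite -[X in f X - _]mul1g.
exact: (uniform_norm_ge (ltransl 1%g f - ltransl u f) y).
Qed.

(** * Functions with compact support *)

Section compact_support.
Context {R : realType} {G : topologicalGroupType}.
Hypothesis hG : hausdorff_space G.
Local Notation X := (luc_dual R G).
Implicit Types (p q m : X) (g h : G) (K : set G).

(** The covering form of compactness makes both local boundedness and local continuity uniform over
    [K]. *)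
Lemma compact_support_luc (f : G -> R[i]) K : continuous f -> compact K ->
  (forall x, ~ K x -> f x = 0) -> exists F : luc R G, forall x, F x = f x.
Proof.
move=> cf cK f0.
have cover := (compact_near_coveringP K).1 cK.
have [M fM] : exists M : R, forall x, K x -> `|f x| <= M%:C.
  have : \forall M \near +oo%R, K `<=` (fun x => `|f x| <= M%:C).
    apply: (cover R _ (fun M x => `|f x| <= M%:C)) => x Kx.
    exists ([set y | `|f x - f y| <= 1], [set M : R | complex.Re `|f x| + 1 <= M]).
      split => /=; last exact/nbhs_pinfty_ge/num_real.
      by have /cvgrPdist_le/(_ 1 ltr01) := cf x.
    move=> [y N] /= [fxy fN].
    rewrite -(subrK (f x) (f y)); apply: le_trans (ler_normD _ _) _.
    rewrite -normrN opprB; apply: (@le_trans _ _ (1 + `|f x|)).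
      by rewrite lerD.
    by rewrite addrC (normcRe (f x)) -(rmorph1 (real_complex R)) -rmorphD lecR.
  by move=> /filter_ex[M MK]; exists M.
apply: (@luc_of_unif _ _ f (`|M|%:C)) => [x|e e0].
  have [/fM fxM|/f0 ->] := pselect (K x).
    by apply: le_trans fxM _; rewrite lecR ler_norm.
  by rewrite normr0 lecR.
have near1 : \forall u \near (1%g : G), K `<=` (fun x => `|f x - f (u * x)%g| <= e).
  apply: cover => x Kx.
  have c0 : (fun z : G * G => f z.1 - f (z.2 * z.1)%g) @ (x, 1%g) --> (0 : R[i]).
    rewrite -(subrr (f x)); apply: cvgB.
      by apply: (@continuous_comp _ _ _ fst f (x, 1%g)); [exact: cvg_fst|exact: cf].
    have E : x = ((x, 1%g : G).2 * (x, 1%g : G).1)%g by rewrite /= mul1g.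
    rewrite [X in _ --> f X]E.
    apply: (@continuous_comp _ _ _ (fun z : G * G => (z.2 * z.1)%g) f (x, 1%g)); last exact: cf.
    apply: (@continuous_comp _ _ _ (fun z : G * G => (z.2, z.1))
      (fun z : G * G => (z.1 * z.2)%g)); last exact: mulg_continuous.
    by apply: cvg_pair; [exact: cvg_snd|exact: cvg_fst].
  move/cvgrPdist_le: c0 => /(_ e e0).
  by apply: filterS => -[y u] /=; rewrite sub0r normrN.
(* This version serves the points [y] outside [K] with [u * y] in [K]: it is applied at [u * y]. *)
have near1V : \forall u \near (1%g : G), K `<=` (fun x => `|f x - f (u^-1 * x)%g| <= e).
  have cV : (u^-1)%g @[u --> (1%g : G)] --> (1%g : G).
    have {2}<- : (1^-1 = 1 :> G)%g by exact: invg1.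
    exact: (@invg_continuous G 1%g).
  exact: (cV _ near1).
near=> u => y.
have [Ky|nKy] := pselect (K y); first by move: y Ky; near: u.
have [Kuy|nKuy] := pselect (K (u * y)%g); last by rewrite !f0// subrr normr0 ltW.
have : `|f (u * y)%g - f (u^-1 * (u * y))%g| <= e by move: Kuy; move: (u * y)%g; near: u.
by rewrite mulKg distrC.
Unshelve. all: by end_near. Qed.

Lemma luc_conj (f : luc R G) : exists F : luc R G, forall x, F x = (f x)^*.
Proof.
have /bcfun_predP[_ [M fM]] := bcfun_valP (luc_val f).
apply: (@luc_of_unif _ _ _ M) => [x|e e0]; first by rewrite normcJ.
apply: filterS (luc_unif f e0) => u ue y.
by rewrite -rmorphB normcJ.
Qed.

Lemma luc_addE (k f : luc R G) x : (k + f) x = k x + f x.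
Proof. by []. Qed.

Lemma luc_mulE (k f : luc R G) x : (k * f) x = k x * f x.
Proof. by []. Qed.

Lemma luc_sub_scale1E (k : luc R G) (a : R[i]) (x : G) :
  (k - a *: (1 : luc R G) : luc R G) x = k x - a.
Proof. by rewrite [LHS]/(k x - a * 1) mulr1. Qed.

(* On the compact set K the functional m is not an evaluation, so its kernel
   contains a function that is positive on K; dividing by it shows that m
   vanishes on functions supported by K. *)
Lemma remainder_compact_support m (f : luc R G) K : luc_remainder R G m ->
  compact K -> (forall x, ~ K x -> f x = 0) -> m f = 0.
Proof.
move=> [Sm Em] cK f0.
pose P (A : set G) := exists k : luc R G,
  [/\ m k = 0, forall x, 0 <= k x & forall x, A x -> 0 < k x].
have PU A B : P A -> P B -> P (A `|` B).
  move=> [k [mk k0 kA]] [l [ml l0 lB]]; exists (k + l); split.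
  - by rewrite linearD /= mk ml addr0.
  - by move=> x; rewrite luc_addE addr_ge0.
  - by move=> x [/kA kx|/lB lx]; rewrite luc_addE; [exact: ltr_pwDl|exact: ltr_wpDl].
have PS A B : A `<=` B -> P B -> P A.
  by move=> AB [k [? ? kB]]; exists k; split => // x /AB/kB.
(* As [m] is not the evaluation at [x], its kernel contains some [k] with [k x != 0]; multiplying by
   the conjugate gives the nonnegative function [|k|^2], still in the kernel. *)
have Ploc (x : G) : exists2 U, nbhs x U & P U.
  have [k mk kx] : exists2 k : luc R G, m k = 0 & k x != 0.
    have /existsNP[f1 /eqP mf1] : ~ forall f, m f = f x.
      by move=> mE; apply: Em; exists x => //; apply: luc_dual_eqP => f1; rewrite mE.
    exists (f1 - m f1 *: (1 : luc R G)).
      by rewrite linearB linearZ /= (spectrum1 Sm) mulr1 subrr.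
    rewrite luc_sub_scale1E.
    by rewrite subr_eq0 eq_sym.
  have [kc kcE] := luc_conj k.
  have kk y : (k * kc) y = `|k y| ^+ 2 by rewrite sqr_normc luc_mulE kcE.
  exists [set y | 0 < `|k y|].
    have : 0 < `|k x| by rewrite normr_gt0.
    move=> kx0; have /cvgrPdist_lt/(_ _ kx0) := @luc_continuous _ _ k x.
    apply: filterS => y ky /=; rewrite normr_gt0; apply: contraTneq ky => ->.
    by rewrite subr0 ltxx.
  exists (k * kc); split => [|y|y ky]; first by rewrite (spectrumM _ _ Sm) mk mul0r.
    by rewrite kk exprn_ge0.
  by rewrite kk exprn_gt0.
have [k [mk k0 kK]] : P K.
  (* Otherwise the sets [A] with [P (K \ A)] form a proper filter containing [K]; a cluster point in
     [K] contradicts [Ploc]. *)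
  apply: contrapT => nPK.
  pose F := [set A : set G | P (K `\` A)].
  have FF : ProperFilter F.
    split; first by rewrite /F /= setD0.
    split.
    - rewrite /F /= setDT; exists 0; split => //; first exact: linear0.
    - by move=> A B FA FB; rewrite /F /= setDIr; exact: PU.
    - by move=> A B AB; apply: PS => x [Kx nBx]; split=> // /AB.
  have [|x [Kx clx]] := cK F FF.
    by rewrite /F /= setDv; exists 0; split => //; first exact: linear0.
  have [U Ux PU'] := Ploc x.
  have /(clx _ U)/(_ Ux)[y []//] : F (~` U).
  by apply: PS PU' => y [_ /contrapT].
have clK := compact_closed hG cK.
(* The quotient is continuous: [k] is positive on [K], and [f] vanishes on the open complement of
   [K]. *)
have [||q qE] := @compact_support_luc (fun x => f x / k x) K _ cK.
- move=> x; have [Kx|nKx] := pselect (K x).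
    apply: cvgM; first exact: luc_continuous.
    by apply: cvgV; [rewrite gt_eqF ?kK|exact: luc_continuous].
  apply: cvg_near_cst; rewrite f0// mul0r.
  have : nbhs x (~` K) by apply: open_nbhs_nbhs; split => //; exact: closed_openC.
  by apply: filterS => y nKy; rewrite f0// mul0r.
- by move=> x nKx; rewrite f0// mul0r.
have -> : f = k * q.
  apply/val_inj/val_inj/funext => x /=; rewrite [RHS]luc_mulE qE.
  have [Kx|nKx] := pselect (K x); last by rewrite f0// mul0r mulr0.
  by rewrite mulrC divfK// gt_eqF ?kK.
by rewrite (spectrumM _ _ Sm) mk mul0r.
Qed.
End compact_support.

(** * The remainder of a locally compact group *)

(** The recursion [v] carries the finite set of terms chosen so far, from which the choice function
    [c] produces the next one. *)
Lemma greedy_sequence (T : Type) (P : set T -> T -> Prop) :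
  (forall A, finite_set A -> exists x, P A x) ->
  exists u : nat -> T, forall n, P (u @` `I_n) (u n).
Proof.
move=> exP.
have /choice[c cP] : forall A, exists x, finite_set A -> P A x.
  move=> A; have [/exP[x Px]|nfA] := pselect (finite_set A); first by exists x.
  by have [x _] := exP set0 (finite_set0 _); exists x => /nfA.
pose v := fix v n := if n is n'.+1 then v n' `|` [set c (v n')] else set0.
have vE n : (c \o v) @` `I_n = v n.
  by elim: n => [|n IHn] /=; rewrite ?II0 ?image_set0// IIS image_setU IHn image_set1.
exists (c \o v) => n; rewrite vE; apply: cP; rewrite -vE.
exact/finite_image/finite_II.
Qed.

Section locally_compact_group.
Context {R : realType} {G : topologicalGroupType}.
Hypotheses (hG : hausdorff_space G) (lcG : locally_compact [set: G]).
Local Notation X := (luc_dual R G).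
Local Notation "p ** q" := (luc_dual_mul p q) (at level 40, left associativity).
Local Notation ev := (luc_eval R G).
Implicit Types (p q m : X) (g h : G) (K : set G).

Lemma real_complex_continuous : continuous (fun x : R => (x%:C : R[i])).
Proof.
move=> x; apply/cvgrPdist_le => e e0.
have /complex_realP[r er] := gtr0_real e0.
move: e0; rewrite er ltcR => r0.
near=> y; rewrite -rmorphB normc_def /= expr0n /= addr0 sqrtr_sqr lecR.
by near: y; have /cvgrPdist_le := @cvg_id _ (nbhs x); apply.
Unshelve. all: by end_near. Qed.

Lemma compact_nbhs (x : G) : exists2 K, nbhs x K & compact K.
Proof. by have [K] := lcG (I : setT x); rewrite withinET => Kx [cK _]; exists K. Qed.

(** Complete regularity separates [x] from the complement of the interior of [K] intersected with
    [U], for a compact neighbourhood [K]; the bump is 1 minus the separating function. *)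
Lemma luc_bump (x : G) (U : set G) : nbhs x U ->
  exists (f : luc R G) (K : set G), [/\ compact K, f x = 1,
    forall y, ~ U y -> f y = 0 & forall y, ~ K y -> f y = 0].
Proof.
move=> Ux; have [K Kx cK] := compact_nbhs x.
pose B := ~` (K `&` U)^°.
have clB : closed B by apply/open_closedC/open_interior.
have nBx : ~ B x by apply; exact: filterI.
have := @locally_compact_completely_regular G R lcG hG _ _ clB nBx.
move=> /(uniform_separatorP (R := R))[f [cf _ fx fB]].
have f1 y : ~ (K `&` U) y -> (1 - f y)%:C = 0 :> R[i].
  move=> nKUy; suff -> : f y = 1 by rewrite subrr.
  by apply: fB; exists y => // /interior_subset.
have [||F FE] := @compact_support_luc _ _ (fun y => (1 - f y)%:C : R[i]) K _ cK.
- move=> y; apply: (@continuous_comp _ _ _ (fun y => 1 - f y) (fun x : R => x%:C : R[i])).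
    by apply: cvgB; [exact: cvg_cst|exact: cf].
  exact: real_complex_continuous.
- by move=> y nKy; apply: f1 => -[].
exists F, K; split=> // [|y nUy|y nKy]; rewrite FE; last 2 first.
- by apply: f1 => -[].
- by apply: f1 => -[].
by have -> : f x = 0 by [apply: fx; exists x]; rewrite subr0.
Qed.

(** A limit of points of the remainder kills all functions with compact support, as these points do,
    so it is not the evaluation at [x]: a bump is 1 there. *)
Lemma remainder_compact : compact (luc_remainder R G).
Proof.
rewrite compact_ultra => F UF FE.
have FS : F (luc_spectrum R G) by apply: filterS FE => p [].
have := @spectrum_compact R G; rewrite compact_ultra => /(_ F UF FS)[p [Sp Fp]].
exists p; split=> //; split=> // -[x _ xp].
have [f [K [cK fx _ fK]]] := luc_bump (@filterT _ _ (nbhs_filter x)).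
have Fpf : (fun k : X => k f) @ F --> p f by apply: (luc_dual_cvgP _ _).1.
have F0 : (fun k : X => k f) @ F --> (0 : R[i]).
  apply: cvg_near_cst; apply: filterS FE => k Ek.
  exact: (remainder_compact_support hG Ek cK fK).
have pf0 : p f = 0 by exact: complex_cvg_unique Fpf F0.
by move: pf0; rewrite -xp /= fx => /eqP; rewrite oner_eq0.
Qed.

Lemma remainder_noncompact : luc_remainder R G !=set0 -> ~ compact [set: G].
Proof.
move=> [m Em] cG.
have : m 1 = 0 by apply: (remainder_compact_support hG Em cG) => x [].
by rewrite (spectrum1 (remainder_spectrum Em)) => /eqP; rewrite oner_eq0.
Qed.

(* Sums of translates [f0 (y * (u n)^-1)] with disjoint supports: an ultrafilter
   limit of the [u n] is a point of the remainder that g moves. *)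
Lemma remainder_separates (g : G) : g <> 1%g -> luc_remainder R G !=set0 ->
  exists2 p, luc_remainder R G p & ev g ** p <> p.
Proof.
move=> g1 ER.
have [f0 [K0 [cK0 f01 f0g f0K]]] : exists (f : luc R G) (K : set G),
    [/\ compact K, f 1%g = 1, f g = 0 & forall y, ~ K y -> f y = 0].
  have [|f [K [cK f1 fg fK]]] := @luc_bump 1%g (~` [set g]); last first.
    by exists f, K; split => //; apply: fg; apply.
  apply: open_nbhs_nbhs; split; last by move=> /esym.
  by apply: closed_openC; apply: compact_closed => //; exact: compact_set1.
have [N N1 cN] := compact_nbhs (1%g : G).
pose K1 := K0 `|` N `|` [set g].
have cK1 : compact K1 by do 2?apply: compactU => //; exact: compact_set1.
(* A symmetric compact set containing [g], a neighbourhood of 1 and the support of [f0]. *)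
pose K := K1 `|` (fun x : G => x^-1%g) @` K1.
have cK : compact K.
  apply: compactU => //; apply: continuous_compact => //.
  by apply: continuous_subspaceT => x; exact: invg_continuous.
have KV x : K x -> K x^-1%g.
  move=> [K1x|[y K1y <-]]; first by right; exists x.
  by left; rewrite invgK.
have K_1 : K 1%g by left; left; right; exact: nbhs_singleton.
have Kg : K g by left; right.
have f0nK y : ~ K y -> f0 y = 0 by move=> nK; apply: f0K => K0y; apply: nK; do 3!left.
(* As G is not compact, [u n] can be taken outside the finitely many compact sets [K K u_i]; by
   symmetry of [K] the translates [K u_n] are then disjoint. *)
have [u uP] : exists u : nat -> G, forall n i, (i < n)%N ->
    forall a b, K a -> K b -> u n <> (a * b * u i)%g.
  have [A fA|u uP] := @greedy_sequence G
      (fun A x => forall y, A y -> forall a b, K a -> K b -> x <> (a * b * y)%g).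
    apply: contrapT => /forallNP nP.
    apply: (remainder_noncompact ER).
    pose h (z : G * G * G) := (z.1.1 * z.1.2 * z.2)%g.
    suff -> : setT = h @` (K `*` K `*` A).
      apply: continuous_compact; last first.
        by do 2?apply: compact_setX => //; exact: finite_compact.
      apply: continuous_subspaceT => z.
      apply: (@continuous_comp _ _ _ (fun z : G * G * G => ((z.1.1 * z.1.2)%g, z.2))
        (fun z : G * G => (z.1 * z.2)%g)); last exact: mulg_continuous.
      apply: cvg_pair; last exact: cvg_snd.
      apply: (@continuous_comp _ _ _ (fun z : G * G * G => z.1)
        (fun z : G * G => (z.1 * z.2)%g)); last exact: mulg_continuous.
      exact: cvg_fst.
    apply/seteqP; split=> // x _; apply: contrapT => nx; apply: (nP x) => y Ay a b Ka Kb E.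
    by apply: nx; exists (a, b, y) => //=; rewrite E.
  exists u => n i lt_in a b Ka Kb; exact: (uP n (u i)).
have uniq n i a b : K a -> K b -> (a * u n = b * u i)%g -> n = i.
  have lem k l a' b' : (k < l)%N -> K a' -> K b' -> (a' * u k = b' * u l)%g -> False.
    move=> kl Ka Kb E; apply: (uP l k kl b'^-1%g a' (KV _ Kb) Ka).
    by rewrite -mulgA E mulKg.
  move=> Ka Kb E; case: (ltngtP n i) => // ni; exfalso.
    exact: lem ni Ka Kb E.
  exact: lem ni Kb Ka (esym E).
have uniq' y n i : K (y * (u n)^-1)%g -> K (y * (u i)^-1)%g -> n = i.
  by move=> Kn Ki; apply: uniq Kn Ki _; rewrite !mulgVK.
have /choice[f fP] : forall y, exists v : R[i],
    (forall n, K (y * (u n)^-1)%g -> v = f0 (y * (u n)^-1)%g) /\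
    ((forall n, ~ K (y * (u n)^-1)%g) -> v = 0).
  move=> y; have [[n Kn]|nK] := pselect (exists n, K (y * (u n)^-1)%g).
    exists (f0 (y * (u n)^-1)%g); split; last by move/(_ n).
    by move=> i Ki; rewrite (uniq' _ _ _ Kn Ki).
  by exists 0; split=> // n Kn; exfalso; apply: nK; exists n.
have /bcfun_predP[_ [M f0M]] := bcfun_valP (luc_val f0).
have M0 : 0 <= M by apply: le_trans (f0M 1%g).
have [|e e0|F FE] := @luc_of_unif _ _ f M.
- move=> y; have [fn fz] := fP y.
  have [[n Kn]|nK] := pselect (exists n, K (y * (u n)^-1)%g); first by rewrite (fn n Kn).
  by rewrite fz ?normr0// => n Kn; apply: nK; exists n.
(* If [y] and [w * y] lie in different translates of [K], both values are compared with a value 0 of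
   [f0], which costs [e / 2] twice. *)
- have e20 : 0 < e / 2 by rewrite divr_gt0.
  apply: filterS (luc_unif f0 e20) => w wP y.
  have e2e : e / 2 <= e by rewrite ler_pdivrMr// ler_peMr ?(ltW e0)// ler1n.
  have [fn fz] := fP y; have [gn gz] := fP (w * y)%g.
  have [[n Kn]|nK] := pselect (exists n, K (y * (u n)^-1)%g);
  have [[i Ki]|nKw] := pselect (exists n, K (w * y * (u n)^-1)%g).
  + rewrite (fn n Kn) (gn i Ki).
    have [<-|/eqP ni] := eqVneq n i.
      by rewrite -mulgA; exact: le_trans (wP _) e2e.
    rewrite [leRHS]splitr; apply: le_trans (ler_normB _ _) _; apply: lerD.
      have := wP (y * (u n)^-1)%g; rewrite mulgA (f0nK (w * _ * _)%g) ?subr0//.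
      by move=> Kn'; apply: ni; exact: uniq' Kn' Ki.
    have := wP (y * (u i)^-1)%g; rewrite mulgA (f0nK (y * _)%g) ?sub0r ?normrN//.
    by move=> Ki'; apply: ni; exact: uniq' Kn Ki'.
  + rewrite (fn n Kn) gz; last by move=> i Ki; apply: nKw; exists i.
    have := wP (y * (u n)^-1)%g; rewrite mulgA (f0nK (w * _ * _)%g).
      by move=> /le_trans; apply.
    by move=> Ki; apply: nKw; exists n.
  + rewrite (gn i Ki) fz; last by move=> n Kn; apply: nK; exists n.
    have := wP (y * (u i)^-1)%g; rewrite mulgA (f0nK (y * _)%g).
      by move=> /le_trans; apply.
    by move=> Kn; apply: nK; exists i.
  + rewrite fz; last by move=> n Kn; apply: nK; exists n.
    rewrite gz; last by move=> n Kn; apply: nKw; exists n.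
    by rewrite subrr normr0 ltW.
have [W [UW evW]] := ultraFilterLemma (@eventually_filter).
have UE := fmap_ultra (ev \o u) UW.
have := @spectrum_compact R G; rewrite compact_ultra => /(_ ((ev \o u) @ W) UE)[|p [Sp Wp]].
  by apply: (@filterE _ W) => n; exact: spectrum_eval.
have pE (k : luc R G) : (fun n => k (u n)) @ W --> p k.
  exact: ((@luc_dual_fmap_cvgP R G nat W (ev \o u) p _).1 Wp k).
have pcst (k : luc R G) (c : R[i]) : (\forall n \near \oo, k (u n) = c) -> p k = c.
  move=> kc; apply: (complex_cvg_unique (pE k)); apply: cvg_near_cst.
  exact: evW.
exists p.
  split=> // -[x _ xp].
  (* The neighbourhood [N x] contains at most one [u n], so a bump supported there tends to 0 along
     [u], though it is 1 at [x]. *)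
  have [|fx [Kx [_ fx1 fxN _]]] := @luc_bump x [set y | N (y * x^-1)%g].
    have := @mulg_continuousr G x^-1%g x; rewrite /continuous_at mulgV; exact.
  have : p fx = 0.
    apply: pcst.
    have [[n Nn]|nN] := pselect (exists n, N (u n * x^-1)%g); last first.
      by apply: nearW => n; apply: fxN => Nn; apply: nN; exists n.
    exists n.+1 => // i /= ni; apply: fxN => Ni.
    apply: (uP i n ni (u i * x^-1)%g (u n * x^-1)^-1%g).
    - by left; left; right.
    - by apply: KV; left; left; right.
    - by rewrite invgM invgK mulgA mulgVK -!mulgA mulVg mulg1.
  by rewrite -xp /= fx1 => /eqP; rewrite oner_eq0.
move=> gp.
have p1 : p F = 1.
  apply: pcst; apply: nearW => n; rewrite FE.
  by rewrite ((fP (u n)).1 n) mulgV.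
have : (ev g ** p) F = 0.
  rewrite eval_mulE; apply: pcst; apply: nearW => n.
  rewrite -[LHS]/(F (g * u n)%g) FE.
  by rewrite ((fP (g * u n)%g).1 n) -mulgA mulgV mulg1.
by rewrite gp p1 => /eqP; rewrite oner_eq0.
Qed.
End locally_compact_group.

(** * Ultrafilters on a discrete group *)

(* [concentrated p A]: p lies in the closure of A in G^luc. For discrete G and
   p in G^luc, these sets A form the ultrafilter corresponding to p. *)
Definition concentrated (R : realType) (G : topologicalGroupType)
    (p : luc_dual R G) : set_system G := fun A =>
  forall F : luc R G, (forall x, A x -> F x = 0) -> p F = 0.

Section discrete_group.
Context {R : realType} {G : topologicalGroupType}.
Hypotheses (dG : forall A : set G, open A).
Local Notation X := (luc_dual R G).
Local Notation S := (luc_spectrum R G).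
Local Notation E := (luc_remainder R G).
Local Notation "p ** q" := (luc_dual_mul p q) (at level 40, left associativity).
Local Notation ev := (luc_eval R G).
Local Notation conc := (@concentrated R G).
Implicit Types (p q m : X) (g h : G) (A B : set G).

Lemma discrete_hausdorff : hausdorff_space G.
Proof.
move=> x y /(_ [set x] [set y])[||z [-> ->]//]; apply: open_nbhs_nbhs; split=> //; exact: dG.
Qed.

Lemma luc_discrete (f : G -> R[i]) (M : R[i]) :
  (forall x, `|f x| <= M) -> exists F : luc R G, forall x, F x = f x.
Proof.
move=> fM; apply: (luc_of_unif fM) => e e0.
have : nbhs (1%g : G) [set 1%g] by apply: open_nbhs_nbhs; split=> //; exact: dG.
by apply: filterS => _ -> y; rewrite mul1g subrr normr0 ltW.
Qed.

Lemma luc_indicator A : exists F : luc R G,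
  (forall x, A x -> F x = 1) /\ (forall x, ~ A x -> F x = 0).
Proof.
have [|F FE] := @luc_discrete (fun x => (x \in A)%:R) 1.
  by move=> x; rewrite normr_nat lern1; case: (x \in A).
by exists F; split=> x Ax; rewrite FE; [rewrite mem_set|rewrite memNset].
Qed.

Lemma concentratedT p : conc p setT.
Proof.
move=> F F0; have -> : F = 0 by apply/val_inj/val_inj/funext => x; exact: F0.
exact: linear0.
Qed.

Lemma concentratedS p A B : A `<=` B -> conc p A -> conc p B.
Proof. by move=> AB pA F F0; apply: pA => x /AB/F0. Qed.

(** For intersections, [F] vanishing on [A] and [B] together splits as [F - F * I], zero on [A],
    plus [F * I], zero on [B], where [I] is the indicator of [A]. *)
Lemma concentrated_proper p : S p -> ProperFilter (conc p).
Proof.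
move=> Sp; split.
  move=> /(_ 1); rewrite (spectrum1 Sp) => p0.
  by have /eqP := p0 (fun x (F : False) => match F with end); rewrite oner_eq0.
split.
- exact: concentratedT.
- move=> A B pA pB F F0; have [I [I1 I0]] := luc_indicator A.
  rewrite -[F](subrK (F * I)) linearD /= pA ?pB ?addr0//.
    move=> x Bx; rewrite luc_mulE; have [Ax|/I0 ->] := pselect (A x); last by rewrite mulr0.
    by rewrite F0// mul0r.
  move=> x Ax; rewrite -[LHS]/(F x - F x * I x).
  by rewrite (I1 x Ax) mulr1 subrr.
- by move=> A B; exact: concentratedS.
Qed.

(** The indicators of [A] and of its complement have product 0, so [p] kills one of them and all its
    multiples. *)
Lemma concentrated_ultra p : S p -> UltraFilter (conc p).
Proof.
move=> Sp; apply: proper_ultra; first exact: concentrated_proper.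
move=> A; have [I [I1 I0]] := luc_indicator A.
have [J [J1 J0]] := luc_indicator (~` A).
have : p I * p J = 0.
  rewrite -(spectrumM _ _ Sp) (_ : I * J = 0) ?linear0//.
  apply/val_inj/val_inj/funext => x /=; rewrite [LHS]luc_mulE.
  by have [Ax|nAx] := pselect (A x); [rewrite J0 ?mulr0//; exact|rewrite I0 ?mul0r].
move=> /eqP; rewrite mulf_eq0 => /orP[/eqP pI|/eqP pJ]; [right|left] => F F0.
  have -> : F = F * I.
    apply/val_inj/val_inj/funext => x /=; rewrite [RHS]luc_mulE.
    have [Ax|nAx] := pselect (A x); first by rewrite (I1 x Ax) mulr1.
    by rewrite F0// mul0r.
  by rewrite (spectrumM _ _ Sp) pI mulr0.
have -> : F = F * J.
  apply/val_inj/val_inj/funext => x /=; rewrite [RHS]luc_mulE.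
  have [Ax|nAx] := pselect (A x); first by rewrite F0// mul0r.
  by rewrite J1// mulr1.
by rewrite (spectrumM _ _ Sp) pJ mulr0.
Qed.

Lemma concentratedC p A : S p -> conc p A \/ conc p (~` A).
Proof. by move=> Sp; apply: in_ultra_setVsetC; exact: concentrated_ultra. Qed.

Lemma concentratedI p A B : S p -> conc p A -> conc p B -> conc p (A `&` B).
Proof. by move=> /concentrated_proper PF; exact: filterI. Qed.

Lemma concentrated_ex p A : S p -> conc p A -> A !=set0.
Proof. by move=> /concentrated_proper PF; exact: filter_ex. Qed.

Lemma concentrated_disjoint p A B : S p -> conc p A -> conc p B ->
  exists2 x, A x & B x.
Proof.
by move=> Sp pA pB; have [x []] := concentrated_ex Sp (concentratedI Sp pA pB); exists x.
Qed.

Lemma concentratedNC p A : S p -> ~ conc p A -> conc p (~` A).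
Proof. by move=> /concentratedC-/(_ A)[]. Qed.

Lemma concentrated_eval g A : conc (ev g) A <-> A g.
Proof.
split=> [gA|Ag F F0]; last exact: F0.
apply: contrapT => nAg; have [I [I1 I0]] := luc_indicator (~` A).
have /eqP : ev g I = 0 by apply: gA => x Ax; apply: I0; exact.
by rewrite /= I1// oner_eq0.
Qed.

(** Otherwise [f - p f] is bounded away from 0 on a set where [p] is concentrated, and has there a
    bounded inverse up to sign, [k]; the product with [k] is killed by [p] but equals -1 on that
    set. *)
Lemma concentrated_cvg p (f : luc R G) : S p -> f @ conc p --> p f.
Proof.
move=> Sp; have PF := concentrated_proper Sp; apply/cvgrPdist_lt => e e0.
apply: contrapT => /(concentratedNC Sp) fe.
have [|k kE] := @luc_discrete
    (fun x => if `|p f - f x| < e then 0 else (p f - f x)^-1) e^-1.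
  move=> x; case: ifPn => [_|]; first by rewrite normr0 invr_ge0 ltW.
  rewrite -real_leNgt ?normr_real ?gtr0_real// => fxe.
  by rewrite normfV lef_pV2// posrE// (lt_le_trans e0).
have : p ((f - p f *: (1 : luc R G)) * k) = 0.
  by rewrite (spectrumM _ _ Sp) linearB linearZ /= (spectrum1 Sp) mulr1 subrr mul0r.
have -> : (f - p f *: (1 : luc R G)) * k = (- 1 + ((f - p f *: (1 : luc R G)) * k + 1)).
  by rewrite addrCA addNr addr0.
rewrite linearD linearN /= (spectrum1 Sp) fe ?addr0.
  by move=> /eqP; rewrite oppr_eq0 oner_eq0.
move=> x /negP fxe; rewrite luc_addE luc_mulE luc_sub_scale1E kE (negbTE fxe).
rewrite -[X in X * _]opprB mulNr divff ?addNr//.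
apply: contraNneq fxe => ->; by rewrite normr0.
Qed.

Lemma concentrated_inj p q : S p -> S q -> (forall A, conc p A -> conc q A) -> p = q.
Proof.
move=> Sp Sq pq; apply: luc_dual_eqP => f.
have PF := concentrated_proper Sq.
have pf := @concentrated_cvg p f Sp; have qf := @concentrated_cvg q f Sq.
have pq_cvg : f @ conc q --> p f by move=> A pfA; apply: pq; exact: pf.
exact: complex_cvg_unique pq_cvg qf.
Qed.

Lemma concentrated_neq p q : S p -> S q -> p <> q ->
  exists A, conc p A /\ conc q (~` A).
Proof.
move=> Sp Sq pq; apply: contrapT => /forallNP nA; apply: pq.
apply: concentrated_inj => // A pA; apply: contrapT => /(concentratedNC Sq) qA.
exact: (nA A).
Qed.

(** Point evaluations converge along an ultrafilter finer than [U], and the limit is concentrated on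
    its members. *)
Lemma concentrated_exists (U : set_system G) : ProperFilter U ->
  exists2 p, S p & forall A, U A -> conc p A.
Proof.
move=> PU; have [W [UW UsubW]] := ultraFilterLemma PU.
have UE := fmap_ultra ev UW.
have := @spectrum_compact R G; rewrite compact_ultra => /(_ (ev @ W) UE)[|p [Sp Wp]].
  by apply: (@filterE _ W) => n; exact: spectrum_eval.
exists p => // A UA F F0.
have WF : (fun x => F x) @ W --> p F.
  exact: ((@luc_dual_fmap_cvgP R G G W ev p _).1 Wp F).
apply: (complex_cvg_unique WF); apply: cvg_near_cst.
by apply: (filterS _ (UsubW _ UA)) => x /F0.
Qed.

(** This is the usual product of ultrafilters. The introversion formula gives the implication from
    right to left; applied to the complement of [A], it gives the converse. *)
Lemma concentrated_mul p q A : S p -> S q ->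
  conc (p ** q) A <-> conc p [set g | conc q [set x | A (g * x)%g]].
Proof.
move=> Sp Sq.
have imp B : conc p [set g | conc q [set x | B (g * x)%g]] -> conc (p ** q) B.
  move=> pB F F0; rewrite luc_dual_mulE; apply: pB => g gB.
  by apply: gB => x /F0.
split; last exact: imp.
move=> pqA; apply: contrapT => /(concentratedNC Sp) pnA.
have Spq := spectrum_mul Sp Sq.
have [|x] := @concentrated_disjoint (p ** q) A (~` A) Spq pqA; last by [].
apply: imp; apply: concentratedS pnA => g gA.
exact: (concentratedNC Sq).
Qed.

Lemma concentrated_eval_mul g p A : S p ->
  conc (ev g ** p) A <-> conc p [set x | A (g * x)%g].
Proof.
move=> Sp; rewrite (concentrated_mul _ (spectrum_eval g) Sp).
exact: concentrated_eval.
Qed.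

Lemma concentrated_mul_eval g p A : S p ->
  conc (p ** ev g) A <-> conc p [set x | A (x * g)%g].
Proof.
move=> Sp; rewrite (concentrated_mul _ Sp (spectrum_eval g)).
split; apply: concentratedS => x /=; first by move/concentrated_eval.
by move=> ?; apply/concentrated_eval.
Qed.

Lemma concentrated_infinite p A : E p -> conc p A -> infinite_set A.
Proof.
move=> Ep pA fA; have [I [I1 I0]] := luc_indicator A.
have Sp := remainder_spectrum Ep.
have pI : p I = 0.
  by apply: (remainder_compact_support discrete_hausdorff Ep (finite_compact fA)).
have : p 1 = 0.
  rewrite -[1](subrK I) linearD /= pI addr0 pA// => x Ax.
  by rewrite -[LHS]/(1 - I x) I1// subrr.
by rewrite (spectrum1 Sp) => /eqP; rewrite oner_eq0.
Qed.

(** The sets containing all but finitely many points of [A] form a proper filter, and a point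
    refining it is concentrated off every singleton. *)
Lemma remainder_exists A : infinite_set A -> exists2 p, E p & conc p A.
Proof.
move=> iA.
pose U := [set B | finite_set (A `\` B)].
have PU : ProperFilter U.
  split; first by rewrite /U /= setD0.
  split.
  - by rewrite /U /= setDT; exact: finite_set0.
  - by move=> B C; rewrite /U /= setDIr finite_setU.
  - by move=> B C BC; apply: sub_finite_set; exact: setDS.
have [p Sp pU] := concentrated_exists PU.
exists p; last by apply: pU; rewrite /U /= setDv; exact: finite_set0.
split=> // -[g _ gp].
have : conc p (~` [set g]).
  by apply: pU; rewrite /U /= setDE setCK; apply: finite_setIr; exact: finite_set1.
by rewrite -gp => /concentrated_eval; apply.
Qed.

Lemma spectrum_cases p : S p -> E p \/ exists g, p = ev g.
Proof.
move=> Sp; have [[g _ <-]|nE] := pselect (range ev p); first by right; exists g.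
by left; split.
Qed.

Lemma remainder_mul p q : E p -> E q -> E (p ** q).
Proof.
move=> Ep Eq; have [Sp Sq] := (remainder_spectrum Ep, remainder_spectrum Eq).
split; first exact: spectrum_mul.
move=> [g _ gpq].
have : conc (p ** q) [set g] by rewrite -gpq; apply/concentrated_eval.
rewrite concentrated_mul// => /(concentrated_ex Sp)[h /(concentrated_infinite Eq)]; apply.
apply: (sub_finite_set _ (finite_set1 (h^-1 * g)%g)) => x /= <-.
by rewrite mulKg.
Qed.

(** The indicator of the complement of [A] is 0 at [p], and is 1 at any point of the spectrum not
    concentrated on [A]. *)
Lemma concentrated_nbhs p A : S p -> conc p A ->
  \forall q \near p, S q -> conc q A.
Proof.
move=> Sp pA; have [I [I1 I0]] := luc_indicator (~` A).
have pI : p I = 0 by apply: pA => x Ax; apply: I0; exact.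
have /cvgrPdist_lt/(_ 1 ltr01) := @luc_dual_eval_continuous _ _ I p.
apply: filterS => q; rewrite pI sub0r normrN => qI Sq.
have [//|qA] := concentratedC A Sq.
have q1 : q 1 = q I.
  apply/eqP; rewrite -subr_eq0 -linearB; apply/eqP/qA => x nAx.
  by rewrite -[LHS]/(1 - I x) I1// subrr.
by move: qI; rewrite -q1 (spectrum1 Sq) normr1 ltxx.
Qed.

(** With [concentrated_nbhs], this identifies the topology of the spectrum with that of the space of
    ultrafilters: [q f] is a limit of values of [f], so it is near [p f] once [q] is concentrated
    where [f] is near [p f]. *)
Lemma nbhs_concentrated p (O : set X) : S p -> nbhs p O ->
  exists A, conc p A /\ forall q, S q -> conc q A -> O q.
Proof.
move=> Sp pO.
pose F := filter_from (conc p) (fun A => [set q | S q /\ conc q A]).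
have PF := concentrated_proper Sp.
have FF : Filter F.
  apply: filter_from_filter; first by exists setT; exact: filterT.
  move=> A B pA pB; exists (A `&` B); first exact: concentratedI.
  by move=> q [Sq qAB]; split; split=> //; apply: concentratedS qAB => x [].
have Fp : F --> p.
  apply/luc_dual_cvgP => f; apply/cvgrPdist_le => e e0.
  have e20 : 0 < e / 2 by rewrite divr_gt0.
  have /cvgrPdist_le/(_ _ e20) pf := @concentrated_cvg p f Sp.
  exists [set x | `|p f - f x| <= e / 2] => // q [Sq qA].
  have QF := concentrated_proper Sq.
  have /cvgrPdist_le/(_ _ e20) qf := @concentrated_cvg q f Sq.
  have [x /= px qx] := concentrated_disjoint Sq qA qf.
  rewrite /= [leRHS]splitr (_ : p f - q f = (p f - f x) - (q f - f x)); last first.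
    by rewrite opprB addrA subrK.
  by apply: le_trans (ler_normB _ _) _; exact: lerD.
have [A pA AO] := Fp _ pO.
by exists A; split => // q Sq qA; apply: AO.
Qed.

End discrete_group.

(** * Thin sets *)

(** Countability places [T] in a countable subgroup; the two finiteness conditions make left and
    right translations act freely on points concentrated on [T]. *)
Definition thin (G : topologicalGroupType) (T : set G) :=
  [/\ infinite_set T, countable T,
    forall g : G, g <> 1%g -> finite_set (T `&` [set x | T (g * x)%g]) &
    forall g : G, g <> 1%g -> finite_set (T `&` [set x | T (x * g)%g])].

(** Each term is chosen outside all products [a * b^-1 * c] of earlier terms. Two overlaps of [T]
    with a translate by [g] express [g] in two ways, and then the latest term involved would be such
    a product. *)
Lemma thin_exists (G : topologicalGroupType) (Y : set G) : infinite_set Y ->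
  exists2 T, T `<=` Y & thin T.
Proof.
move=> iY.
have [A fA|u uP] := @greedy_sequence G
    (fun A x => Y x /\ forall a b c, A a -> A b -> A c -> x <> (a * b^-1 * c)%g).
  pose B := (fun z : G * G * G => (z.1.1 * z.1.2^-1 * z.2)%g) @` (A `*` A `*` A).
  have fB : finite_set B by apply: finite_image; do 2?apply: finite_setX.
  have [x [Yx nBx]] := infinite_setN0 (infinite_setD iY fB).
  exists x; split=> // a b c Aa Ab Ac xE; apply: nBx.
  by exists (a, b, c).
have Yu n : Y (u n) by case: (uP n).
have uN n i j k : (i < n)%N -> (j < n)%N -> (k < n)%N ->
    u n <> (u i * (u j)^-1 * u k)%g.
  by move=> ? ? ?; apply: (uP n).2; [exists i|exists j|exists k].
have u_inj : injective u.
  have lem m n : (m < n)%N -> u n <> u m.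
    by move=> mn /esym E; apply: (uN n m m m) => //; rewrite mulgV mul1g.
  by move=> m n E; case: (ltngtP m n) => // /lem; rewrite E.
exists (range u); first by move=> _ [n _ <-].
have fin_below (A : set G) n : A `<=` range u -> (forall m, A (u m) -> (m <= n)%N) ->
    finite_set A.
  move=> Au An; apply: (@sub_finite_set _ _ (u @` `I_n.+1)); last exact/finite_image/finite_II.
  by move=> x Ax; have [m _ mx] := Au x Ax; exists m => //=; rewrite ltnS An ?mx.
split.
- move=> fu; apply: infinite_nat.
  by apply: sub_finite_set (finite_preimage (in2W u_inj) fu) => n _; exists n.
- exact: card_le_trans (card_image_le _ _) (countableP _).
- move=> g g1; set A := _ `&` _.
  have [->|/set0P[_ [[n0 _ <-] [m0 _ E0]]]] := eqVneq A set0; first exact: finite_set0.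
  have gE : g = (u m0 * (u n0)^-1)%g by rewrite E0 mulgK.
  apply: (fin_below _ (maxn n0 m0)) => [x []//|n [_ [m _ E]]].
  rewrite leqNgt; apply/negP; rewrite gtn_max => /andP[n0n m0n].
  have [mn|nm|mn] := ltngtP m n.
  + apply: (uN n n0 m0 m) => //.
    by rewrite E gE !mulgA mulgVK mulgV mul1g.
  + apply: (uN m m0 n0 n (ltn_trans m0n nm) (ltn_trans n0n nm) nm).
    by rewrite E gE.
  + by apply: g1; move: E; rewrite mn => /esym/(canRL (mulgK _)); rewrite mulgV.
- move=> g g1; set A := _ `&` _.
  have [->|/set0P[_ [[n0 _ <-] [m0 _ E0]]]] := eqVneq A set0; first exact: finite_set0.
  have gE : g = ((u n0)^-1 * u m0)%g by rewrite E0 mulKg.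
  apply: (fin_below _ (maxn n0 m0)) => [x []//|n [_ [m _ E]]].
  rewrite leqNgt; apply/negP; rewrite gtn_max => /andP[n0n m0n].
  have [mn|nm|mn] := ltngtP m n.
  + apply: (uN n m m0 n0) => //.
    by rewrite E gE -!mulgA mulVKg mulVg mulg1.
  + apply: (uN m n n0 m0 nm (ltn_trans n0n nm) (ltn_trans m0n nm)).
    by rewrite E gE mulgA.
  + by apply: g1; move: E; rewrite mn => /esym/(canRL (mulKg _)); rewrite mulVg.
Qed.

Lemma countable_subgroup (G : topologicalGroupType) (C : set G) : countable C ->
  exists r : nat -> G, [/\ C `<=` range r, range r 1%g,
    forall x y, range r x -> range r y -> range r (x * y)%g &
    forall x, range r x -> range r x^-1%g].
Proof.
move=> /countable_injP[f f_inj].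
pose u n := xget 1%g [set x | C x /\ f x = n].
have uf x : C x -> u (f x) = x.
  move=> Cx; rewrite /u; case: xgetP => [y -> [Cy fyx]|/(_ x)[]//].
  by apply: f_inj; rewrite ?inE.
pose letter (z : nat * bool) := if z.2 then u z.1 else (u z.1)^-1%g.
pose word (s : seq (nat * bool)) := foldr (fun z g => (letter z * g)%g) 1%g s.
have word_cat s t : word (s ++ t) = (word s * word t)%g.
  by elim: s => [|z s IHs] /=; rewrite ?mul1g// IHs mulgA.
have word_inv s : exists t, word t = (word s)^-1%g.
  elim: s => [|[n b] s [t tE]]; first by exists [::]; rewrite /= invg1.
  exists (t ++ [:: (n, ~~ b)]); rewrite word_cat tE /= mulg1 invgM /letter /=.
  by case: b => //=; rewrite invgK.
(* Numbers coding no word are sent to 1, the empty word, so the range is exactly the subgroup of all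
   words. *)
pose r n := odflt 1%g (omap word (unpickle n)).
have rangeE x : range r x <-> exists s, word s = x.
  split=> [[n _ <-]|[s <-]]; last by exists (pickle s) => //; rewrite /r pickleK.
  by rewrite /r; case: unpickle => [s|] /=; [exists s|exists [::]].
exists r; split.
- by move=> x Cx; apply/rangeE; exists [:: (f x, true)]; rewrite /= mulg1 /letter /= uf.
- by apply/rangeE; exists [::].
- move=> x y /rangeE[s <-] /rangeE[t <-]; apply/rangeE.
  by exists (s ++ t).
- by move=> x /rangeE[s <-]; apply/rangeE.
Qed.

Lemma filter_forall_ltn (T : Type) (F : set_system T) (P : nat -> set T) n :
  Filter F -> (forall i, (i < n)%N -> F (P i)) ->
  F [set x | forall i, (i < n)%N -> P i x].
Proof.
move=> FF; elim: n => [|n IHn] FP; first by apply: filterE => x.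
apply: (filterS _ (filterI (IHn (fun i ni => FP i (ltnW ni))) (FP n (leqnn _)))).
by move=> x [xP Pn] i; rewrite ltnS leq_eqVlt => /orP[/eqP ->|/xP].
Qed.

Section thin_points.
Context {R : realType} {G : topologicalGroupType}.
Hypotheses (dG : forall A : set G, open A).
Local Notation X := (luc_dual R G).
Local Notation S := (luc_spectrum R G).
Local Notation E := (luc_remainder R G).
Local Notation "p ** q" := (luc_dual_mul p q) (at level 40, left associativity).
Local Notation ev := (luc_eval R G).
Local Notation conc := (@concentrated R G).
Implicit Types (p q m : X) (g h : G) (A B : set G).

Section thin_point.
Variables (p : X) (T : set G).
Hypotheses (Ep : E p) (thinT : thin T) (pT : conc p T).

Let Sp : S p := remainder_spectrum Ep.

(** If a translation by [k <> 1] fixed [p], then [p] would be concentrated on the finite overlap of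
    [T] with a translate. *)
Lemma thin_eval_mul_inj g h : ev g ** p = ev h ** p -> g = h.
Proof.
move=> gh; have E1 : ev (h^-1 * g)%g ** p = p.
  by rewrite -eval_mul -luc_dual_mulA gh eval_mulK.
apply: contrapT => ngh; have hg1 : (h^-1 * g)%g <> 1%g.
  by move=> /(canRL (mulVKg _)); rewrite mulg1.
have [_ _ /(_ _ hg1) fT _] := thinT.
apply: (concentrated_infinite dG Ep _ fT); apply: concentratedI => //.
by apply/(concentrated_eval_mul dG) => //; rewrite E1.
Qed.

Lemma thin_mul_eval_inj g h : p ** ev g = p ** ev h -> g = h.
Proof.
move=> gh; have E1 : p ** ev (g * h^-1)%g = p.
  by rewrite -eval_mul luc_dual_mulA gh mul_evalK.
apply: contrapT => ngh; have hg1 : (g * h^-1)%g <> 1%g.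
  by move=> /(canRL (mulgVK _)); rewrite mul1g.
have [_ _ _ /(_ _ hg1) fT] := thinT.
apply: (concentrated_infinite dG Ep _ fT); apply: concentratedI => //.
by apply/(concentrated_mul_eval dG) => //; rewrite E1.
Qed.

(** Otherwise [m] is concentrated on [g^-1 T] for infinitely many [g], and two of these sets meet in
    a finite set. *)
Lemma thin_not_mul q m : E q -> E m -> p <> q ** m.
Proof.
move=> Eq Em pE; have [Sq Sm] := (remainder_spectrum Eq, remainder_spectrum Em).
have : conc (q ** m) T by rewrite -pE.
rewrite (concentrated_mul dG)//; set A := [set g | _] => qA.
have iA := concentrated_infinite dG Eq qA.
have [g Ag] := infinite_setN0 iA.
have [h [Ah ngh]] := infinite_setN0 (infinite_setD iA (finite_set1 g)).
have hg1 : (h * g^-1)%g <> 1%g.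
  by move=> /(canRL (mulgVK _)); rewrite mul1g => /ngh.
have [_ _ /(_ _ hg1) fT _] := thinT.
apply: (concentrated_infinite dG Em (concentratedI dG Sm Ag Ah)).
have : finite_set ((fun x => g^-1 * x)%g @` (T `&` [set x | T (h * g^-1 * x)%g])).
  exact: finite_image.
apply: sub_finite_set => x [/= Tgx Thx].
by exists (g * x)%g; rewrite ?mulKg//; split => //=; rewrite mulgA mulgVK.
Qed.

(* The translates [h * T_ h] of suitable subsets [T_ h] of T, still in p, are
   pairwise disjoint. *)
Lemma thin_right_cancel q m : S q -> S m -> q ** p = m ** p -> q = m.
Proof.
move=> Sq Sm qm; have PF := concentrated_proper dG Sp.
have [_ /countable_subgroup[r [Tr r1 rM rV]] finT _] := thinT.
(* A representative of the left coset of [h] modulo the countable group [range r]; [idx h] then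
   gives [h] a position inside its coset. *)
pose c h := xget 1%g [set x | range r (h^-1 * x)%g].
have cP h : range r (h^-1 * c h)%g.
  by rewrite /c; case: xgetP => [x -> //|/(_ h)[]] /=; rewrite mulVg.
have cE h k : range r (h^-1 * k)%g -> c h = c k.
  move=> hk; rewrite /c; congr (xget _ _); apply/seteqP; split=> x /= hx.
    by have := rM _ _ (rV _ hk) hx; rewrite invgM invgK -mulgA mulVKg.
  by have := rM _ _ hk hx; rewrite -mulgA mulVKg.
have /choice[idx idxP] : forall h, exists i, h = (c h * r i)%g.
  move=> h; have [i _ ri] := rV _ (cP h); exists i.
  by rewrite ri invgM invgK mulVKg.
(* Only the finitely many elements listed before [h] in its coset are avoided, and each removes a
   finite part of [T]. *)
pose T_ h := T `&` [set t | forall i, (i < idx h)%N -> (c h * r i)%g <> h ->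
  ~ T ((c h * r i)^-1 * h * t)%g].
have pT_ h : conc p (T_ h).
  apply: concentratedI => //; apply: filter_forall_ltn => i _.
  have [->|/eqP rih] := eqVneq (c h * r i)%g h; first by apply: filterE => t /(_ erefl).
  have k1 : ((c h * r i)^-1 * h)%g <> 1%g.
    by move=> /(canRL (mulVKg _)); rewrite mulg1 => /esym.
  have : conc p (~` [set t | T ((c h * r i)^-1 * h * t)%g]).
    apply: concentratedNC => // pk; apply: (concentrated_infinite dG Ep _ (finT _ k1)).
    exact: concentratedI.
  by apply: concentratedS => t /= nT _.
(* Such an equality puts [h] and [k] in one coset, as [s * t^-1] lies in [range r]; the one with the
   larger index then excludes it. *)
have disj h k t s : T_ h t -> T_ k s -> (h * t = k * s)%g -> h = k.
  have lem h' k' t' s' : T_ h' t' -> T_ k' s' -> (h' * t' = k' * s')%g ->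
      (idx k' < idx h')%N -> False.
    move=> [Tt tP] [Ts sP] E1 kh.
    have ck : c k' = c h'.
      apply: cE; have -> : (k'^-1 * h' = s' * t'^-1)%g.
        by apply: (canRL (mulgK _)); rewrite -mulgA E1 mulKg.
      by apply: rM; [exact: Tr|apply/rV/Tr].
    have E2 : (c h' * r (idx k'))%g = k' by rewrite -ck -idxP.
    apply: (tP _ kh); rewrite E2.
      by move=> kh'; move: kh; rewrite kh' ltnn.
    by rewrite -mulgA E1 mulKg.
  move=> Tt Ts E1; case: (ltngtP (idx h) (idx k)) => hk.
  - by have := lem _ _ _ _ Ts Tt (esym E1) hk.
  - by have := lem _ _ _ _ Tt Ts E1 hk.
  - have ckh : c k = c h.
      apply: cE; have -> : (k^-1 * h = s * t^-1)%g.
        by apply: (canRL (mulgK _)); rewrite -mulgA E1 mulKg.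
      by apply: rM; [apply: Tr; case: Ts|apply/rV/Tr; case: Tt].
    by rewrite (idxP h) (idxP k) ckh hk.
apply: contrapT => /(concentrated_neq dG Sq Sm)[A [qA mA]].
pose U B := [set x | exists h t, [/\ B h, T_ h t & x = (h * t)%g]].
have UP B n : S n -> conc n B -> conc (n ** p) (U B).
  move=> Sn nB; apply/(concentrated_mul dG) => //.
  apply: concentratedS nB => h Bh /=; apply: concentratedS (pT_ h) => t Tt.
  by exists h, t.
have Sqp := spectrum_mul Sq Sp.
have qU := UP _ _ Sq qA.
have mU : conc (q ** p) (U (~` A)) by rewrite qm; exact: UP.
have [x [h [t [Ah Tt xE]]] [k [s [nAk Ts xE']]]] := concentrated_disjoint dG Sqp qU mU.
apply: nAk; rewrite -(disj h k t s)//; by rewrite -xE.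
Qed.

End thin_point.
End thin_points.

(** * Multipliers of the remainder *)

Section separation.
Context {R : realType} {G : topologicalGroupType}.
Hypotheses (dG : forall A : set G, open A).
Local Notation X := (luc_dual R G).
Local Notation S := (luc_spectrum R G).
Local Notation E := (luc_remainder R G).
Local Notation "p ** q" := (luc_dual_mul p q) (at level 40, left associativity).
Local Notation ev := (luc_eval R G).
Local Notation conc := (@concentrated R G).
Implicit Types (p q m x a : X) (g h : G) (A B : set G).

(** If every set of [x] met the orbit of [p] in this sense, the sets of such [h] would generate a
    proper filter, and any point [q] refining it would satisfy [q ** p = x]. *)
Lemma orbit_closure_separation p x : S p -> S x -> (forall q, S q -> x <> q ** p) ->
  exists A, conc x A /\ forall h, ~ conc p [set t | A (h * t)%g].
Proof.
move=> Sp Sx xN; apply: contrapT => /forallNP nA.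
have Aex A : conc x A -> exists h, conc p [set t | A (h * t)%g].
  by move=> xA; apply: contrapT => /forallNP nh; apply: (nA A).
have XF := concentrated_proper dG Sx.
pose U := filter_from (conc x) (fun A => [set h | conc p [set t | A (h * t)%g]]).
have UF : Filter U.
  apply: filter_from_filter; first by exists setT; exact: filterT.
  move=> A B xA xB; exists (A `&` B); first exact: concentratedI.
  by move=> h /= pAB; split; apply: concentratedS pAB => t [].
have UP : ProperFilter U by apply: filter_from_proper => A /Aex.
have [q Sq qU] := @concentrated_exists R _ U UP.
apply: (xN q Sq); apply: (concentrated_inj dG) => //; first exact: spectrum_mul.
move=> A xA; apply/(concentrated_mul dG) => //.
by apply: qU; exists A.
Qed.

(* Enumerating a countable group [range r] that contains T and Y, a diagonal
   choice yields sets [A_ k] of x and [B_ i] of p whose translates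
   [r k * A_ k] and [r i * B_ i] are all disjoint. *)
Lemma countable_left_separation p x (T Y : set G) : E p -> S x ->
  countable T -> conc p T -> countable Y -> conc x Y ->
  (forall q, S q -> x <> q ** p) -> (forall q, S q -> p <> q ** x) ->
  exists2 a, E a & forall b, S b -> a ** x <> b ** p.
Proof.
move=> Ep Sx cT pT cY xY xNp pNx; have Sp := remainder_spectrum Ep.
have PF := concentrated_proper dG Sp; have XF := concentrated_proper dG Sx.
have [A0 [xA0 A0p]] := orbit_closure_separation Sp Sx xNp.
have [B0 [pB0 B0x]] := orbit_closure_separation Sx Sp pNx.
have cTY : countable (T `|` Y) by rewrite -bigcup2E; apply: bigcup_countable => // -[|[|i]] _.
have [r [TYr r1 rM rV]] := countable_subgroup cTY.
have ir : infinite_set (range r).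
  apply: sub_infinite_set (concentrated_infinite dG Ep pT).
  by move=> t Tt; apply: TYr; left.
have [a Ea ar] := @remainder_exists R _ dG _ ir.
have Sa := remainder_spectrum Ea.
exists a => // b Sb abE.
(* [A_ k] takes care of the pairs with [i <= k] and [B_ i] of those with [k <= i]; each imposes
   finitely many conditions. *)
pose A_ k := A0 `&` [set s | forall i, (i < k.+1)%N -> ~ B0 ((r i)^-1 * r k * s)%g].
pose B_ i := B0 `&` [set t | forall k, (k < i.+1)%N -> ~ A0 ((r k)^-1 * r i * t)%g].
have xA_ k : conc x (A_ k).
  apply: concentratedI => //; apply: filter_forall_ltn => i _.
  exact: (concentratedNC dG Sx (B0x _)).
have pB_ i : conc p (B_ i).
  apply: concentratedI => //; apply: filter_forall_ltn => k _.
  exact: (concentratedNC dG Sp (A0p _)).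
pose A := [set z | exists k s, A_ k s /\ z = (r k * s)%g].
pose B := [set z | exists i t, B_ i t /\ z = (r i * t)%g].
have axA : conc (a ** x) A.
  apply/(concentrated_mul dG) => //; apply: concentratedS ar => _ [k _ <-] /=.
  by apply: concentratedS (xA_ k) => s As; exists k, s.
have axr : conc (a ** x) (range r).
  apply/(concentrated_mul dG) => //; apply: concentratedS ar => _ [k _ <-] /=.
  by apply: concentratedS xY => y Yy; apply: rM; [exists k|apply: TYr; right].
(* If [g * t] and [t] both lie in the group [range r], so does [g]; hence [b] lives on the group
   that carries [a ** x]. *)
have br : conc b (range r).
  move: axr; rewrite abE (concentrated_mul dG)//; apply: concentratedS => g /= pg.
  have [t rgt Tt] := concentrated_disjoint dG Sp pg pT.
  rewrite -(mulgK t g); apply: rM => //; apply: rV; apply: TYr; by left.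
have bpB : conc (a ** x) B.
  rewrite abE; apply/(concentrated_mul dG) => //; apply: concentratedS br => _ [i _ <-] /=.
  by apply: concentratedS (pB_ i) => t Bt; exists i, t.
have Sax := spectrum_mul Sa Sx.
have [z [k [s [[A0s As] zE]]] [i [t [[B0t Bt] zE']]]] := concentrated_disjoint dG Sax axA bpB.
have E1 : (r k * s = r i * t)%g by rewrite -zE.
have [ik|ki] := leqP i k.
  by apply: (As i); rewrite ?ltnS// -mulgA E1 mulKg.
by apply: (Bt k); rewrite ?ltnS ?(ltnW ki)// -mulgA -E1 mulKg.
Qed.

End separation.

Section multipliers.
Context {R : realType} {G : topologicalGroupType}.
Hypotheses (dG : forall A : set G, open A).
Local Notation X := (luc_dual R G).
Local Notation S := (luc_spectrum R G).
Local Notation E := (luc_remainder R G).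
Local Notation "p ** q" := (luc_dual_mul p q) (at level 40, left associativity).
Local Notation ev := (luc_eval R G).
Local Notation conc := (@concentrated R G).
Implicit Types (g h : G) (A B : set G).

Lemma remainder_continuous_concentrated (H : topologicalGroupType)
    (u : luc_dual R H -> X) (p : luc_dual R H) A :
  {within luc_remainder R H, continuous u} ->
  (forall q : luc_dual R H, luc_remainder R H q -> S (u q)) ->
  luc_remainder R H p -> conc (u p) A ->
  \forall q \near (p : luc_dual R H), luc_remainder R H q -> conc (u q) A.
Proof.
move=> /subspace_continuousP cu Su Ep upA.
have uA : \forall q \near p, luc_remainder R H q -> S (u q) -> conc (u q) A.
  exact: (cu p Ep _ (concentrated_nbhs dG (Su p Ep) upA)).
by near=> q => Eq; apply: (near uA q) => //; exact: Su.
Unshelve. all: by end_near.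
Qed.

(** [L] and [M] model left and right translation by one group element, transported from another
    remainder; [ML] is then the associativity [(a g) p = a (g p)]. *)
Variables (L L' M : X -> X).
Hypotheses (LE : forall p, E p -> E (L p)) (L'E : forall p, E p -> E (L' p)).
Hypotheses (LK : forall p, E p -> L' (L p) = p) (L'K : forall p, E p -> L (L' p) = p).
Hypotheses (cL : {within E, continuous L}) (cL' : {within E, continuous L'}).
Hypotheses (ME : forall a, E a -> E (M a)).
Hypothesis M_surj : forall p, E p -> exists2 a, E a & M a = p.
Hypothesis ML : forall a p, E a -> E p -> M a ** p = a ** L p.

Let SE p : E p -> S p := @remainder_spectrum _ _ p.

Let continuous_concentrated (u : X -> X) p A : {within E, continuous u} ->
  (forall q, E q -> E (u q)) -> E p -> conc (u p) A ->
  exists B, conc p B /\ forall q, E q -> conc q B -> conc (u q) A.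
Proof.
move=> cu uE Ep upA.
have [B [pB BP]] := nbhs_concentrated dG (SE Ep)
  (remainder_continuous_concentrated cu (fun q Eq => SE (uE q Eq)) Ep upA).
by exists B; split=> // q Eq qB; exact: (BP q (SE Eq) qB Eq).
Qed.

(* As L is open, L p can be taken in the closure of a countable set, which the
   separation of countable sets above requires when G is uncountable. *)
Lemma multiplier_thin_translation (Y : set G) : infinite_set Y ->
  exists p h, [/\ E p, conc p Y, L p = ev h ** p & forall a, E a -> M a = a ** ev h].
Proof.
move=> iY; have [T TY thinT] := thin_exists iY.
have [iT cT _ _] := thinT.
have [p0 Ep0 p0T] := @remainder_exists R _ dG _ iT.
have L'p0T : conc (L' (L p0)) T by rewrite LK.
(* [L'] sends points of the remainder concentrated on [A] to points concentrated on [T]; a thin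
   subset of [A] provides the countable carrier of [x]. *)
have [A [xA AP]] := continuous_concentrated cL' L'E (LE Ep0) L'p0T.
have [Y0 Y0A [iY0 cY0 _ _]] := thin_exists (concentrated_infinite dG (LE Ep0) xA).
have [x Ex xY0] := @remainder_exists R _ dG _ iY0.
pose p := L' x.
have Ep : E p by exact: L'E.
have Lp : L p = x by exact: L'K.
have pT : conc p T by apply: AP => //; exact: concentratedS xY0.
suff [h xE] : exists h, x = ev h ** p.
  exists p, h; split=> //; first exact: concentratedS pT.
    by rewrite Lp.
  move=> a Ea; apply: (thin_right_cancel dG Ep thinT pT).
  - exact/SE/ME.
  - by apply: spectrum_mul; [exact: SE|exact: spectrum_eval].
  - by rewrite ML// Lp xE luc_dual_mulA.
apply: contrapT => /forallNP xNh.
have [q Sq||a Ea aP] := countable_left_separation dG Ep (SE Ex) cT pT cY0 xY0.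
- move=> xE; have [Eq|[h qE]] := spectrum_cases Sq; last first.
    by apply: (xNh h); rewrite xE qE.
  (* Writing [p = M a] and cancelling [p] in [M a ** p = a ** q ** p] would give [p = a ** q]. *)
  have [a Ea aE] := M_surj Ep.
  apply: (thin_not_mul dG thinT pT Ea Eq); rewrite -aE.
  apply: (thin_right_cancel dG Ep thinT pT); first exact/SE/ME.
    by apply: spectrum_mul; exact: SE.
  by rewrite ML// Lp xE luc_dual_mulA.
- move=> q Sq pE; have [Eq|[h qE]] := spectrum_cases Sq.
    exact: (thin_not_mul dG thinT pT Eq Ex).
  by apply: (xNh h^-1%g); rewrite pE qE eval_mulK.
- by apply: (aP (M a)); [exact/SE/ME|rewrite ML// Lp].
Qed.

(** One [h] serves all the points of the previous lemma, since [M] is right translation by [h] and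
    this determines [h] on a thin point. These points are dense, so continuity of [L] extends the
    formula. *)
Lemma multiplier_translation : E !=set0 ->
  exists h, forall p, E p -> L p = ev h ** p.
Proof.
move=> [e Ee].
have iG : infinite_set [set: G].
  exact: (concentrated_infinite dG Ee (concentratedT _)).
have [_ [h [_ _ _ Mh]]] := multiplier_thin_translation iG.
have [T _ thinT] := thin_exists iG; have [iT _ _ _] := thinT.
have [b Eb bT] := @remainder_exists R _ dG _ iT.
exists h => p Ep; apply: contrapT => Lph.
have Ehp := remainder_eval_mul h Ep.
have [A [LpA hpA]] := concentrated_neq dG (SE (LE Ep)) (SE Ehp) Lph.
have [B [pB BP]] := continuous_concentrated cL LE Ep LpA.
have pC : conc p (B `&` [set x | ~ A (h * x)%g]).
  apply: concentratedI => //; first exact: SE.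
  by move/(concentrated_eval_mul dG) : hpA => /(_ (SE Ep)).
have [q [k [Eq qC Lq Mk]]] := multiplier_thin_translation (concentrated_infinite dG Ep pC).
have kh : k = h by apply: (thin_mul_eval_inj dG Eb thinT bT); rewrite -Mk// Mh.
have qA : conc (L q) A by apply: BP => //; apply: concentratedS qC => x [].
have : conc (L q) (~` A).
  rewrite Lq kh; apply/(concentrated_eval_mul dG); first exact: SE.
  by apply: concentratedS qC => x [].
by move=> /(concentrated_disjoint dG (SE (LE Eq)) qA)[].
Qed.

End multipliers.

(** * Isomorphisms onto the remainder of a discrete group *)

Lemma within_continuous_comp (U V W : topologicalType) (A : set U) (B : set V)
    (u : U -> V) (v : V -> W) : {within A, continuous u} ->
  (forall x, A x -> B (u x)) -> {within B, continuous v} ->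
  {within A, continuous (v \o u)}.
Proof.
move=> /subspace_continuousP cu uAB /subspace_continuousP cv.
apply/subspace_continuousP => x Ax O vO.
have uO : \forall y \near x, A y -> B (u y) -> O (v (u y)).
  exact: (cu x Ax _ (cv (u x) (uAB x Ax) O vO)).
suff : \forall y \near x, A y -> O (v (u y)) by [].
by near=> y => Ay; apply: (near uO y) => //; exact: uAB.
Unshelve. all: by end_near. Qed.

(** The points of [B] that [v] sends outside an open set [O'] lie in the image under [u] of a
    compact set, which is closed. *)
Lemma compact_inverse_continuous (U V : topologicalType) (A : set U) (B : set V)
    (u : U -> V) (v : V -> U) : hausdorff_space V -> compact A ->
  {within A, continuous u} -> (forall y, B y -> A (v y)) ->
  (forall y, B y -> u (v y) = y) -> (forall x, A x -> v (u x) = x) ->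
  {within B, continuous v}.
Proof.
move=> hV cA cu vBA uK vK; apply/subspace_continuousP => y By O.
rewrite nbhsE => -[O' [oO' O'v] O'O].
have cK : compact (u @` (A `&` ~` O')).
  apply: continuous_compact; last by apply: compact_closedI => //; exact: open_closedC.
  by apply: continuous_subspaceW cu => x [].
have nK : nbhs y (~` (u @` (A `&` ~` O'))).
  apply: open_nbhs_nbhs; split; first exact: closed_openC (compact_closed hV cK).
  by move=> [x [Ax nOx] xy]; apply: nOx; rewrite -(vK x Ax) xy.
suff : \forall z \near y, B z -> O (v z) by [].
apply: filterS nK => z nKz Bz; apply: O'O; apply: contrapT => nOz.
by apply: nKz; exists (v z); [split => //; exact: vBA|exact: uK].
Qed.

(** * Extensions of homomorphisms and their uniqueness *)

Section extension.
Context {R : realType} {G H : topologicalGroupType}.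
Local Notation "p ** q" := (luc_dual_mul p q) (at level 40, left associativity).

Lemma luc_extension_spectrum (psi : continuous_hom G H) (p : luc_dual R G) :
  luc_spectrum R G p -> luc_spectrum R H (luc_extension psi p).
Proof.
move=> Sp; apply: spectrumP => [|f1 f2].
  rewrite -(spectrum1 Sp); congr (p _).
  exact/val_inj/val_inj/funext.
rewrite -[RHS](spectrumM _ _ Sp); congr (p _).
exact/val_inj/val_inj/funext.
Qed.

Lemma luc_extension_eval_mul (psi : continuous_hom G H) g (p : luc_dual R G) :
  luc_extension psi (luc_eval R G g ** p) =
  luc_eval R H (psi g) ** luc_extension psi p.
Proof.
apply: luc_dual_eqP => f; rewrite !eval_mulE.
congr (p _); apply/val_inj/val_inj/funext => x /=.
by rewrite (continuous_homP psi).2.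
Qed.

Lemma luc_extension_concentrated (psi : continuous_hom G H) (p : luc_dual R G) B :
  concentrated p (psi @^-1` B) -> concentrated (luc_extension psi p) B.
Proof. by move=> pB F F0; apply: pB => x; exact: F0. Qed.

Lemma luc_extension_range (psi : continuous_hom G H) (p : luc_dual R G) :
  concentrated (luc_extension psi p) (range psi).
Proof.
apply: luc_extension_concentrated; apply: concentratedS (concentratedT p).
by move=> g _; exists g.
Qed.

Lemma luc_extensionK (psi : continuous_hom G H) (theta : continuous_hom H G)
    (p : luc_dual R G) : cancel psi theta ->
  luc_extension theta (luc_extension psi p) = p.
Proof.
move=> psiK; apply: luc_dual_eqP => f; congr (p _).
by apply/val_inj/val_inj/funext => x /=; rewrite psiK.
Qed.

Lemma topological_iso_discrete (psi : continuous_hom G H) :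
  topological_iso psi -> (forall A : set G, open A) -> forall A : set H, open A.
Proof.
move=> [theta psiK thetaK] dG A.
have -> : A = theta @^-1` (psi @^-1` A).
  by apply/seteqP; split=> x /=; rewrite thetaK.
by apply: open_comp => // x _; exact: (continuous_homP theta).1.
Qed.

Lemma continuous_hom_eq (psi theta : continuous_hom G H) : psi =1 theta -> psi = theta.
Proof.
case: psi theta => [u Pu] [v Pv] /= /funext uv.
by case: _ / uv in Pv *; congr ContinuousHom; exact: Prop_irrelevance.
Qed.

(** Both [psi g] and [theta g] translate [phi p] to the image of [ev g ** p]; when [phi p] is
    concentrated on a thin set this determines the translating element. *)
Lemma continuous_isomorphism_extension_unique (phi : luc_dual R G -> luc_dual R H)
    (dH : forall A : set H, open A) (psi theta : continuous_hom G H) :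
  luc_remainder R G !=set0 -> continuous_isomorphism phi ->
  (forall p, luc_remainder R G p -> phi p = luc_extension psi p) ->
  (forall p, luc_remainder R G p -> phi p = luc_extension theta p) ->
  psi = theta.
Proof.
move=> [e Ee] [[phiE _ phi_surj] _ _] phi_psi phi_theta; apply: continuous_hom_eq => g.
have iH : infinite_set [set: H].
  exact: (concentrated_infinite dH (phiE _ Ee) (concentratedT _)).
have [T _ thinT] := thin_exists iH; have [iT _ _ _] := thinT.
have [q Eq qT] := @remainder_exists R _ dH _ iT.
have [p Ep pq] := phi_surj q Eq.
apply: (thin_eval_mul_inj dH Eq thinT qT).
rewrite -[in LHS]pq -[in RHS]pq {1}phi_psi// -luc_extension_eval_mul.
rewrite phi_theta// -luc_extension_eval_mul.
have Egp := remainder_eval_mul g Ep.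
by rewrite -phi_psi// -phi_theta.
Qed.

End extension.

(** * Translations transported to a discrete group *)

Section isomorphism_to_discrete.
Context {R : realType} {G D : topologicalGroupType}.
Hypotheses (hG : hausdorff_space G) (lcG : locally_compact [set: G]).
Hypothesis dD : forall A : set D, open A.
Variable phi : luc_dual R G -> luc_dual R D.
Hypotheses (remainder_neq0 : luc_remainder R G !=set0)
  (phi_iso : continuous_isomorphism phi).
Local Notation "p ** q" := (luc_dual_mul p q) (at level 40, left associativity).
Local Notation EG := (luc_remainder R G).
Local Notation ED := (luc_remainder R D).
Local Notation evG := (luc_eval R G).
Local Notation evD := (luc_eval R D).

Lemma continuous_isomorphism_inverse (K : topologicalGroupType)
    (u : luc_dual R G -> luc_dual R K) :
  continuous_isomorphism u -> exists v : luc_dual R K -> luc_dual R G,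
    [/\ forall q, luc_remainder R K q -> EG (v q),
      forall q, luc_remainder R K q -> u (v q) = q,
      forall p, EG p -> v (u p) = p &
      {within luc_remainder R K, continuous v}].
Proof.
move=> [[uE u_inj u_surj] cu _].
have /choice[v vP] : forall q, exists p, luc_remainder R K q -> EG p /\ u p = q.
  move=> q; have [/u_surj[p Ep pq]|nq] := pselect (luc_remainder R K q).
    by exists p.
  (* Outside the remainder of [K] the value is arbitrary. *)
  by have [p _] := remainder_neq0; exists p => /nq.
have vE q : luc_remainder R K q -> EG (v q) by move=> /vP[].
have uK q : luc_remainder R K q -> u (v q) = q by move=> /vP[].
have vK p : EG p -> v (u p) = p.
  move=> Ep; apply: u_inj; rewrite ?inE//; last exact/uK/uE.
  exact/vE/uE.
exists v; split => //.
exact: (compact_inverse_continuous (@luc_dual_hausdorff R K)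
  (remainder_compact hG lcG) cu vE uK vK).
Qed.

Lemma translation_exists : exists psi : G -> D,
  forall g p, EG p -> phi (evG g ** p) = evD (psi g) ** phi p.
Proof.
have [chi [chiE chiK phiK cchi]] := continuous_isomorphism_inverse phi_iso.
have [[phiE _ _] cphi phiM] := phi_iso.
suff /choice[psi psiP] : forall g, exists h, forall p,
    EG p -> phi (evG g ** p) = evD h ** phi p by exists psi.
move=> g.
pose L k q := phi (evG k ** chi q).
have LE k q : ED q -> ED (L k q).
  by move=> Eq; apply/phiE/remainder_eval_mul/chiE.
have cL k : {within ED, continuous (L k)}.
  apply: (@within_continuous_comp _ _ _ _ EG (fun q => evG k ** chi q)) cphi.
    apply: (@within_continuous_comp _ _ _ _ setT chi (fun p => evG k ** p)) => //.
    by apply: continuous_subspaceT; exact: eval_mul_continuous.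
  by move=> q Eq; exact/remainder_eval_mul/chiE.
have Lcancel k l q : (l * k = 1)%g -> ED q -> L l (L k q) = q.
  move=> lk Eq; rewrite /L phiK; last exact/remainder_eval_mul/chiE.
  by rewrite luc_dual_mulA eval_mul lk eval1_mul chiK.
have ED0 : ED !=set0 by have [e Ee] := remainder_neq0; exists (phi e); exact: phiE.
have [||||a Ea|p Ep|a p Ea Ep|//|h hP] := @multiplier_translation _ _ dD
    (L g) (L g^-1%g) (fun q => phi (chi q ** evG g)) _ _ _ _ (cL g) (cL g^-1%g).
- exact: LE.
- exact: LE.
- by move=> p Ep; apply: Lcancel => //; exact: mulVg.
- by move=> p Ep; apply: Lcancel => //; exact: mulgV.
- by apply/phiE/remainder_mul_eval/chiE.
- exists (phi (chi p ** evG g^-1%g)).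
    exact/phiE/remainder_mul_eval/chiE.
  rewrite phiK; last exact/remainder_mul_eval/chiE.
  by rewrite mul_evalKV chiK.
- rewrite -[in LHS](chiK p Ep) -phiM; [|exact/remainder_mul_eval/chiE|exact: chiE].
  rewrite -luc_dual_mulA phiM; [|exact: chiE|exact/remainder_eval_mul/chiE].
  by rewrite chiK.
- exists h => p Ep; rewrite -(hP _ (phiE _ Ep)) /L phiK//.
Qed.

End isomorphism_to_discrete.

Section isomorphism_onto_discrete.
Context {R : realType} {G D : topologicalGroupType}.
Hypotheses (hG : hausdorff_space G) (lcG : locally_compact [set: G]).
Hypothesis dD : forall A : set D, open A.
Variable phi : luc_dual R G -> luc_dual R D.
Hypotheses (remainder_neq0 : luc_remainder R G !=set0)
  (phi_iso : continuous_isomorphism phi).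
Local Notation "p ** q" := (luc_dual_mul p q) (at level 40, left associativity).
Local Notation EG := (luc_remainder R G).
Local Notation ED := (luc_remainder R D).
Local Notation evG := (luc_eval R G).
Local Notation evD := (luc_eval R D).

Lemma discrete_codomain_extension : exists psi : continuous_hom G D,
  topological_iso psi /\ forall p, EG p -> phi p = luc_extension psi p.
Proof.
have [u uP] := translation_exists hG lcG dD remainder_neq0 phi_iso.
have [[phiE phi_inj phi_surj] cphi phiM] := phi_iso.
have iD : infinite_set [set: D].
  have [e Ee] := remainder_neq0.
  exact: (concentrated_infinite dD (phiE _ Ee) (concentratedT _)).
have [T _ thinT] := thin_exists iD; have [iT _ finT _] := thinT.
have [q0 Eq0 q0T] := @remainder_exists R _ dD _ iT.
have [p0 Ep0 p0q0] := phi_surj q0 Eq0.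
have [Sq0 Sp0] := (remainder_spectrum Eq0, remainder_spectrum Ep0).
have thin_inj := thin_eval_mul_inj dD Eq0 thinT q0T.
have u_mul : {morph u : g h / (g * h)%g}.
  move=> g h; apply: thin_inj.
  rewrite -eval_mul -p0q0 -luc_dual_mulA -!uP// -?luc_dual_mulA ?eval_mul//.
    by rewrite luc_dual_mulA eval_mul.
  exact: remainder_eval_mul.
have u_inj : injective u.
  move=> g h gh; apply: contrapT => ngh.
  have hg1 : (h^-1 * g)%g <> 1%g.
    by move=> /(canRL (mulVKg _)); rewrite mulg1.
  have [p Ep] := remainder_separates hG lcG hg1 remainder_neq0; apply.
  have gph : evG g ** p = evG h ** p.
    apply: phi_inj; rewrite ?inE; try exact: remainder_eval_mul.
    by rewrite !uP// gh.
  by rewrite -eval_mul -luc_dual_mulA gph eval_mulK.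
(* For [h] near [g], continuity keeps [phi (evG h ** p0)] concentrated on the translate [A] of [T];
   if [u h] differed from [u g], then [q0] would be concentrated on a finite overlap. *)
have u_loc g : \forall h \near g, u h = u g.
  pose A := [set x | T ((u g)^-1 * x)%g].
  have Egp := remainder_eval_mul g Ep0.
  have gA : concentrated (phi (evG g ** p0)) A.
    rewrite uP// p0q0; apply/(concentrated_eval_mul dD) => //.
    by apply: concentratedS q0T => x Tx; rewrite /A /= mulKg.
  have phiA := remainder_continuous_concentrated dD cphi
    (fun p Ep => remainder_spectrum (phiE p Ep)) Egp gA.
  have {}phiA : \forall h \near g, EG (evG h ** p0) -> concentrated (phi (evG h ** p0)) A.
    exact: (orbit_continuous phiA).
  apply: filterS phiA => h /(_ (remainder_eval_mul h Ep0)).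
  rewrite uP// p0q0 (concentrated_eval_mul dD)// => hA.
  apply: contrapT => nhg; have k1 : ((u g)^-1 * u h)%g <> 1%g.
    by move=> /(canRL (mulVKg _)); rewrite mulg1.
  apply: (concentrated_infinite dD Eq0 _ (finT _ k1)).
  apply: concentratedI => //; apply: concentratedS hA => x.
  by rewrite /A /= mulgA.
have dG (A : set G) : open A.
  rewrite openE => g Ag; have := u_loc g.
  by apply: filterS => h /u_inj ->.
have u_cont : continuous u.
  move=> g O uO; have := u_loc g; apply: filterS => h hg.
  by rewrite /= hg; exact: nbhs_singleton.
pose psi : continuous_hom G D := ContinuousHom (conj u_cont u_mul).
(* After right multiplication by [q0], both sides are the limit of
   [evD (u g) ** q0 = phi (evG g ** p0)] as [g] tends to [p]. *)
have phi_psi p : EG p -> phi p = luc_extension psi p.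
  move=> Ep; have Sp := remainder_spectrum Ep.
  have Spsi := luc_extension_spectrum psi Sp.
  apply: (thin_right_cancel dD Eq0 thinT q0T) => //; first exact/remainder_spectrum/phiE.
  have Epp := remainder_mul dG Ep Ep0.
  rewrite -[in LHS]p0q0 -phiM//.
  apply: (concentrated_inj dD); [exact/remainder_spectrum/phiE|exact: spectrum_mul|].
  move=> A ppA; apply/(concentrated_mul dD) => //.
  have phiA := remainder_continuous_concentrated dD cphi
    (fun p Ep => remainder_spectrum (phiE p Ep)) Epp ppA.
  have [B [ppB BP]] := nbhs_concentrated dG (remainder_spectrum Epp) phiA.
  apply: luc_extension_concentrated.
  move: ppB; rewrite (concentrated_mul dG)//; apply: concentratedS => g gB /=.
  have Egp := remainder_eval_mul g Ep0.
  have : concentrated (phi (evG g ** p0)) A.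
    apply: BP => //; first exact: remainder_spectrum.
    exact/(concentrated_eval_mul dG).
  by rewrite uP// p0q0 (concentrated_eval_mul dD).
have range_inf : infinite_set (range u).
  apply: (concentrated_infinite dD (phiE _ Ep0)); rewrite phi_psi//.
  exact: luc_extension_range.
(* For [y] outside the subgroup [range u], the coset [C] is infinite and disjoint from it, whereas
   every point of the remainder is concentrated on [range u]. *)
have u_surj y : exists x, u x = y.
  apply: contrapT => /forallNP ny.
  pose C := [set z | exists g, z = (y * u g)%g].
  have iC : infinite_set C.
    move=> fC; apply: range_inf.
    apply: (sub_finite_set _ (finite_image (fun z => y^-1 * z)%g fC)).
    by move=> _ [g _ <-]; exists (y * u g)%g; [exists g|rewrite mulKg].
  have [q Eq qC] := @remainder_exists R _ dD _ iC.
  have [p Ep pq] := phi_surj q Eq.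
  have qr : concentrated q (range u).
    by rewrite -pq phi_psi//; exact: luc_extension_range.
  have [z [g zE] [h _ zE']] := concentrated_disjoint dD (remainder_spectrum Eq) qC qr.
  apply: (ny (h * g^-1)%g); apply: (can_inj (mulgK (u g))) => /=.
  by rewrite -u_mul mulgVK zE' zE.
have /choice[v vP] := u_surj.
have v_mul : {morph v : x y / (x * y)%g}.
  by move=> x y; apply: u_inj; rewrite u_mul !vP.
have v_cont : continuous v.
  move=> x O /nbhs_singleton vO.
  have : nbhs x [set x] by apply: open_nbhs_nbhs; split=> //; exact: dD.
  by apply: filterS => _ ->.
exists psi; split=> //.
exists (ContinuousHom (conj v_cont v_mul)) => x /=; last exact: vP.
by apply: u_inj; rewrite vP.
Qed.

End isomorphism_onto_discrete.

(** For compact groups the remainders are empty and [phi] carries no information about the groups;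
    [remainder_neq0] excludes this case. *)
Theorem theorem3p7 (R : realType) (G H : topologicalGroupType)
    (G_hausdorff : hausdorff_space G) (G_lc : locally_compact [set: G])
    (H_hausdorff : hausdorff_space H) (H_lc : locally_compact [set: H])
    (phi : luc_dual R G -> luc_dual R H)
    (remainder_neq0 : luc_remainder R G !=set0)
    (phi_iso : continuous_isomorphism phi)
    (discreteGH :
      (forall A : set G, open A) \/ (forall A : set H, open A)) :
  (exists! psi : continuous_hom G H,
    topological_iso psi /\
    forall p, luc_remainder R G p -> phi p = luc_extension psi p) /\
  (exists psi : continuous_hom G H, topological_iso psi).
Proof.
suff [psi [psi_iso phi_psi]] : exists psi : continuous_hom G H,
    topological_iso psi /\
    forall p, luc_remainder R G p -> phi p = luc_extension psi p.
  split; last by exists psi.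
  exists psi; split=> // theta [_ phi_theta].
  have dH : forall A : set H, open A.
    by case: discreteGH => // dG; exact: topological_iso_discrete psi_iso dG.
  exact: (continuous_isomorphism_extension_unique dH remainder_neq0 phi_iso).
case: discreteGH => [dG|dH]; last exact: discrete_codomain_extension.
have [[phiE phi_inj phi_surj] cphi phiM] := phi_iso.
(* For discrete G the previous case applies to the inverse [chi], and the inverse of the
   homomorphism so obtained extends to [phi]. *)
have [chi [chiE phiK chiK cchi]] :=
  continuous_isomorphism_inverse G_hausdorff G_lc remainder_neq0 phi_iso.
have [||psi' [[psi psi'K psiK] chi_psi']] :=
    @discrete_codomain_extension R H G H_hausdorff H_lc dG chi.
- by have [p Ep] := remainder_neq0; exists (phi p); exact: phiE.
- split=> [|//|p q Ep Eq].
    split=> [//|p q|p Ep].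
      by rewrite !inE => Ep Eq pq; rewrite -(phiK p Ep) pq phiK.
    by exists (phi p); [exact: phiE|exact: chiK].
  rewrite -[in LHS](phiK p Ep) -[in LHS](phiK q Eq) -phiM; try exact: chiE.
  by rewrite chiK//; apply: remainder_mul => //; exact: chiE.
- exists psi; split; first by exists psi'.
  move=> p Ep; rewrite -[in RHS](chiK p Ep) chi_psi'; last exact: phiE.
  by rewrite luc_extensionK.
Qed.
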